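(* Let $K$ be a Markov kernel on $(\mathcal{X},\mathcal{B}(\mathcal{X}))$ with invariant distribution $\pi$, let $p\in(1,\infty)$ and $f\in L^p_0(\pi)$. If $K$ admits a spectral gap, i.e. $\kappa:=\|K\|_{L^2_0(\pi)\to L^2_0(\pi)}<1$, then $L^p_0(\pi)$ contains exactly one solution $u$ of Poisson's equation with forcing function $f$, i.e. exactly one $u\in L^p_0(\pi)$ with $u-Ku=f$ in $L^p(\pi)$, and $$\|u\|_{L^p(\pi)}\le\begin{cases}\dfrac{2^{2/p}}{1-\kappa^{2\frac{p-1}{p}}}\,\|f\|_{L^p(\pi)} & \text{if } p\in(1,2),\\[1.5ex] \dfrac{1}{1-\kappa}\,\|f\|_{L^2(\pi)} & \text{if } p=2,\\[1.2ex] \dfrac{2^{2\frac{p-1}{p}}}{1-\kappa^{2/p}}\,\|f\|_{L^p(\pi)} & \text{if } p\in(2,\infty).\end{cases}$$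
   Context: $\mathcal{X}$ is a Polish space with Borel $\sigma$-algebra $\mathcal{B}(\mathcal{X})$. For a Markov kernel $K$ with invariant distribution $\pi$ (i.e. $\pi K=\pi$), $Kf(x)=\int f(x')K(x,dx')$ defines a bounded linear operator on each real space $L^p(\pi)$. $L^p_0(\pi)=\{f\in L^p(\pi):\int f\,d\pi=0\}$ with the $L^p(\pi)$ norm, and $\|K\|_{L^2_0(\pi)\to L^2_0(\pi)}=\sup\{\|Kf\|_{L^2(\pi)}: f\in L^2_0(\pi),\ \|f\|_{L^2(\pi)}\le1\}$. *)

(* Defs.v *)
From HB Require Import structures.
From mathcomp Require Import all_boot all_order all_algebra.
From mathcomp Require Import all_classical all_reals all_analysis.

Set Implicit Arguments.
Unset Strict Implicit.
Unset Printing Implicit Defensive.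

Import Order.TTheory GRing.Theory Num.Theory.
Import numFieldNormedType.Exports.

Local Open Scope classical_set_scope.
Local Open Scope ring_scope.

Definition separable (X : topologicalType) :=
  exists2 D : set X, countable D & dense D.

(* The metric is not part of the data of X: X is only required to be
   homeomorphic to some complete metric space. *)
Definition completely_metrizable (R : realType) (X : topologicalType) :=
  exists (M : metricType R) (h : X -> M) (g : M -> X),
    [/\ cancel h g, cancel g h, continuous h, continuous g
      & forall F : set_system M, ProperFilter F -> cauchy F -> exists x : M, F --> x].

Definition polish (R : realType) (X : topologicalType) :=
  separable X /\ completely_metrizable R X.

Notation borel X := (g_sigma_algebraType (@open X)).

Section markov.
Context {d : measure_display} {T : measurableType d} {R : realType}.
Implicit Types (K : R.-pker T ~> T) (pi : probability T R) (f : T -> R).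

Definition invariant_distribution K pi :=
  forall A, measurable A -> (\int[pi]_x K x A = pi A)%E.

(* For f in L^p(pi) with pi invariant and p >= 1, f is integrable with respect
   to K x for pi-almost every x; elsewhere the value is immaterial. *)
Definition markov_op K f : T -> R := fun x => \int[K x]_y f y.

(* Elements of L^p_0(pi) are represented by functions, which have to be
   identified when they are equal pi-almost everywhere. *)
Definition Lfun0 pi (p : R) : set (T -> R) :=
  [set f | f \in Lfun pi p%:E /\ \int[pi]_x f x = 0].

Definition opnorm_L20 pi K : \bar R :=
  ereal_sup [set 'N[pi]_2%:E[EFin \o markov_op K f]%E
            | f in [set f | Lfun0 pi 2 f /\ ('N[pi]_2%:E[EFin \o f] <= 1)%E]].

Definition poisson_solution pi K (p : R) f u :=
  Lfun0 pi p u /\ ((fun x => u x - markov_op K u x) = f %[ae pi]).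

End markov.

(* Main.v *)
Require Import Defs.
From HB Require Import structures.
From mathcomp Require Import all_boot all_order all_algebra.
From mathcomp Require Import all_classical all_reals all_analysis.
From mathcomp Require Import measurable_realfun ring lra.

Set Implicit Arguments.
Unset Strict Implicit.
Unset Printing Implicit Defensive.

Import Order.TTheory GRing.Theory Num.Theory.
Import numFieldNormedType.Exports.

Local Open Scope classical_set_scope.
Local Open Scope ring_scope.

(** The equation is solved by the Neumann series u = sum_n K^n f, and everything
    rests on a geometric bound for the iterates of K on mean-zero functions,

      |K^n f|_p <= 2^(2/p - 1) * (kappa^(2(p-1)/p))^n * |f|_p   if 1 < p < 2,
      |K^n f|_p <= 2^(1 - 2/p) * (kappa^(2/p))^n      * |f|_p   if p > 2,

    and kappa^n * |f|_2 if p = 2, which is the spectral gap itself.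
    On L^2_0 the operator K^n has norm at most kappa^n, on L^1 and on L^oo it is
    a contraction, and centering a function at most doubles its L^1 or L^oo norm;
    the two bounds are the resulting interpolation inequalities.  The theorem
    follows by summing the geometric series, since 2^(2/p - 1) <= 2^(2/p) and
    2^(1 - 2/p) <= 2^(2(p-1)/p).

    The interpolation is done by real methods and loses no constant.  Write |y|^p
    as a superposition over the levels t > 0 of functions phi_t(y) that are
    infima over the splittings y = a + b: of a^2 + 2t|b| when p < 2 (huber), and
    of b^2 under the constraint |a| <= t when p > 2 (excess2).  The infimum is
    attained by clipping y at height t.  Applying an operator to the optimal
    splitting of f bounds the integral of phi_t(K^n f) by a multiple of the
    integral of phi_(alpha t)(f), alpha being the ratio that balances the two
    endpoint norms.  Integrating over t turns this into an inequality between
    p-th powers of norms, where homogeneity of phi produces exactly the power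
    of alpha that the Riesz-Thorin theorem would give (layer_cake_compare,
    interpolation_L1_L2, interpolation_L2_Loo).

    The bound also gives uniqueness, because a mean-zero w with K w = w satisfies
    w = K^n w for all n.  For existence, the sum of the |K^n f| is integrable, so
    the series converges almost everywhere; Fatou's lemma bounds the L^p norm of
    its sum, and dominated convergence, applied to pi and to K(x, .) for
    pi-almost every x, gives mean zero and the equation. *)

(** * Integrals over the real line *)

Section lebesgue_line.
Context {R : realType}.
Local Notation mu := (@lebesgue_measure R).
Implicit Types (f : R -> \bar R) (b c : R).

Lemma lebesgue_measure_shift c (A : set R) : measurable A ->
  pushforward mu ((fun x => x + c) : _ -> measurableTypeR R) A = mu A.
Proof.
move=> mA; have mc : measurable_fun [set: measurableTypeR R]
    ((fun x => x + c) : measurableTypeR R -> measurableTypeR R).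
  exact: measurable_funD.
apply/esym.
apply: lebesgue_measure_unique => //= _ [[a b]] _ <-.
rewrite /pushforward/=.
rewrite (_ : (fun x => x + c) @^-1` `]a, b]%classic = `](a - c), (b - c)]%classic).
  rewrite !lebesgue_measure_itv/= !lte_fin ltrD2r; case: ifPn => // _.
  by rewrite -!EFinB; congr EFin; lra.
by apply/seteqP; split => x /=; rewrite !in_itv/= ltrBlDr lerBrDr.
Qed.

Lemma ge0_integral_shift c f : measurable_fun setT f -> (forall x, 0 <= f x)%E ->
  (\int[mu]_x f ((x : R) + c)%R = \int[mu]_x f x)%E.
Proof.
move=> mf f0.
have mc : measurable_fun [set: measurableTypeR R]
    ((fun x => x + c) : measurableTypeR R -> measurableTypeR R).
  exact: measurable_funD.
rewrite -[LHS]/(\int[mu]_(x in (fun x : R => (x + c)%R) @^-1` setT)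
  (f \o (fun x : R => (x + c)%R)) x)%E.
rewrite -(ge0_integral_pushforward mc)//.
by apply: eq_measure_integral => A mA _; exact: lebesgue_measure_shift.
Qed.

Lemma ge0_integral_opp f : measurable_fun setT f -> (forall x, 0 <= f x)%E ->
  (\int[mu]_x f (- x)%R = \int[mu]_x f x)%E.
Proof.
move=> mf f0.
have mc : measurable_fun [set: measurableTypeR R]
    (-%R : measurableTypeR R -> measurableTypeR R) by [].
rewrite -[LHS]/(\int[mu]_(x in -%R @^-1` setT) (f \o -%R) x)%E.
rewrite -(ge0_integral_pushforward mc)//.
by apply: eq_measure_integral => A mA _; exact: lebesgue_measureN.
Qed.

Lemma integral_expR_Nabs_lty b : 0 < b ->
  (\int[mu]_x (expR (- b * `|x|))%:E < +oo)%E.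
Proof.
move=> b0; pose q := exponential_pdf b.
have mq : measurable_fun setT q by exact: measurable_exponential_pdf.
have q0 x : 0 <= q x by apply: exponential_pdf_ge0; exact: ltW.
apply: (@le_lt_trans _ _ (\int[mu]_x ((b^-1 * q x)%:E + (b^-1 * q (- x))%:E))%E).
  apply: ge0_le_integral => //.
  - apply/measurable_EFinP; apply: (measurableT_comp (@measurable_expR R)).
    by apply: measurable_funM => //; exact: measurableT_comp.
  - apply: emeasurable_funD; apply/measurable_EFinP; apply: measurable_funM => //.
    exact: measurableT_comp.
  - move=> x _; rewrite -EFinD lee_fin -mulrDr.
    have qE y : 0 <= y -> b^-1 * q y = expR (- b * `|y|).
      move=> y0; rewrite /q exponential_pdfE// ger0_norm//.
      by rewrite mulrA mulVf ?gt_eqF// mul1r.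
    have b0' : 0 <= b^-1 by rewrite invr_ge0 ltW.
    have [x0|x0] := leP 0 x.
      by rewrite mulrDr qE// lerDl mulr_ge0.
    have nx : 0 <= - x by rewrite oppr_ge0 ltW.
    by rewrite mulrDr (qE _ nx) normrN lerDr mulr_ge0.
rewrite ge0_integralD//; last 4 first.
- by move=> x _; rewrite lee_fin mulr_ge0// invr_ge0 ltW.
- by apply/measurable_EFinP; apply: measurable_funM.
- by move=> x _; rewrite lee_fin mulr_ge0// invr_ge0 ltW.
- apply/measurable_EFinP; apply: measurable_funM => //.
  exact: measurableT_comp.
have bq : (\int[mu]_x (b^-1 * q x)%:E = (b^-1)%:E)%E.
  under eq_integral do rewrite EFinM.
  rewrite ge0_integralZl//.
  - by rewrite integral_exponential_pdf// mule1.
  - exact/measurable_EFinP.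
  - by move=> x _; rewrite lee_fin.
  - by rewrite lee_fin invr_ge0 ltW.
rewrite (@ge0_integral_opp (fun x => (b^-1 * q x)%:E)).
- by rewrite bq -EFinD ltry.
- by apply/measurable_EFinP; apply: measurable_funM.
- by move=> x; rewrite lee_fin mulr_ge0// invr_ge0 ltW.
Qed.

End lebesgue_line.

(** * Clipping at height t, and the two splitting functionals *)

Section clip.
Context {R : realType}.
Implicit Types (t c y a b : R).

Definition clip t y : R := Num.max (- t) (Num.min t y).

Lemma clip_scale c t y : 0 < c -> clip (c * t) (c * y) = c * clip t y.
Proof. by move=> c0; rewrite /clip maxr_pMr ?ltW// minr_pMr ?ltW// mulrN. Qed.

Variant clip_spec t y : R -> Prop :=
| ClipId of - t <= y & y <= t : clip_spec t y y
| ClipAbove of t < y : clip_spec t y t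
| ClipBelow of y < - t : clip_spec t y (- t).

Lemma clipP t y : 0 <= t -> clip_spec t y (clip t y).
Proof.
move=> t0; rewrite /clip; case: (ltP t y) => [ty|yt].
  by rewrite max_r ?(le_trans _ t0) ?oppr_le0//; exact: ClipAbove.
by case: (leP (- t) y) => [ty|yt']; [exact: ClipId|exact: ClipBelow].
Qed.

Lemma clipN t y : 0 <= t -> clip t (- y) = - clip t y.
Proof. by move=> t0; case: (clipP y t0); case: (clipP (- y) t0); lra. Qed.

Lemma normr_clip_le t y : 0 <= t -> `|clip t y| <= t.
Proof. by move=> t0; rewrite ler_norml; case: (clipP y t0); lra. Qed.

Lemma normr_subr_clip_le t y : 0 <= t -> `|y - clip t y| <= `|y|.
Proof.
move=> t0; rewrite ler_norml; have := ler_norm y; have := ler_norm (- y).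
by rewrite normrN; case: (clipP y t0); lra.
Qed.

Lemma measurable_clip : measurable_fun setT (fun z : R * R => clip z.1 z.2).
Proof.
apply: measurable_maxr.
  exact: (measurableT_comp (@oppr_measurable R _) measurable_fst).
by apply: measurable_minr; [exact: measurable_fst|exact: measurable_snd].
Qed.

(** The minimum of a^2 + 2t|b| over the splittings y = a + b: up to the factor 2,
    Huber's function, quadratic on [-t, t] and affine outside. *)
Definition huber t y : R := clip t y ^+ 2 + 2 * t * `|y - clip t y|.

(** The minimum of b^2 over the splittings y = a + b with |a| <= t. *)
Definition excess2 t y : R := (y - clip t y) ^+ 2.

Lemma huber_split t a b : 0 <= t -> huber t (a + b) <= a ^+ 2 + 2 * t * `|b|.
Proof.
move=> t0; have := ler_norm b; have := ler_norm (- b); rewrite normrN /huber => nb pb.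
case: (clipP (a + b) t0) => [h1 h2|h|h].
- rewrite subrr normr0 mulr0 addr0.
  have [b0|b0] := leP 0 b.
    rewrite ger0_norm// in nb pb *.
    have : 0 <= b * (t - a - b) by apply: mulr_ge0; lra.
    nra.
  rewrite ltr0_norm// in nb pb *.
  have : 0 <= - b * (t + a + b) by apply: mulr_ge0; lra.
  nra.
- rewrite ger0_norm; last by lra.
  have : 0 <= (a - t) ^+ 2 by exact: sqr_ge0.
  have : 0 <= t * (`|b| - b) by apply: mulr_ge0; lra.
  lra.
- rewrite ler0_norm; last by lra.
  have : 0 <= (a + t) ^+ 2 by exact: sqr_ge0.
  have : 0 <= t * (`|b| + b) by apply: mulr_ge0; lra.
  lra.
Qed.

Lemma excess2_split t a b : `|a| <= t -> excess2 t (a + b) <= b ^+ 2.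
Proof.
move=> at_; have t0 : 0 <= t by rewrite (le_trans _ at_).
move: at_; rewrite ler_norml => /andP[at1 at2].
rewrite /excess2; case: (clipP (a + b) t0) => [h1 h2|h|h].
- by rewrite subrr expr0n/= sqr_ge0.
- have : 0 <= (t - a) * (b + (a + b - t)) by apply: mulr_ge0; lra.
  lra.
- have : 0 <= (t + a) * (- b - (a + b + t)) by apply: mulr_ge0; lra.
  lra.
Qed.

End clip.

(** * Powers as superpositions of homogeneous functions *)

Section layer_cake.
Context d (T : measurableType d) {R : realType}.
Variables (mu : {sigma_finite_measure set T -> \bar R}) (phi : R -> R -> R).
(* The exponent of interest is p = gam + 2; the level is t = exp s, for which the
   weight t^(p-3) dt becomes exp (gam s) ds. *)
Variable gam : R.
Hypothesis phi_ge0 : forall t y, 0 < t -> 0 <= phi t y.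
Hypothesis phi0 : forall t, 0 < t -> phi t 0 = 0.
Hypothesis phi_norm : forall t y, 0 < t -> phi t `|y| = phi t y.
Hypothesis phi_scale : forall c t y, 0 < c -> 0 < t ->
  phi (c * t) (c * y) = c ^+ 2 * phi t y.
Hypothesis mphi : measurable_fun setT (fun z : R * R => phi z.1 z.2).
Local Notation leb := (@lebesgue_measure R).

Let J : \bar R := (\int[leb]_s (expR (gam * s) * phi (expR s) 1)%:E)%E.

Let measurable_layer d' (X : measurableType d') (a : R) (s f : X -> R) :
  measurable_fun setT s -> measurable_fun setT f ->
  measurable_fun setT (fun x => (expR (gam * s x) * phi (a * expR (s x)) (f x))%:E).
Proof.
move=> ms mf; apply/measurable_EFinP; apply: measurable_funM.
  by apply: (measurableT_comp (@measurable_expR R)); exact: measurable_funM.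
apply: (measurableT_comp mphi (g := fun x => (a * expR (s x), f x))).
apply: measurable_fun_pair => //=.
by apply: measurable_funM => //; apply: (measurableT_comp (@measurable_expR R)).
Qed.

(** In the variable s = ln t, rescaling the level is a translation: by homogeneity
    phi (a e^s) y is y^2 phi (e^(s + L)) 1 with L = ln (a / |y|), and translation
    invariance of Lebesgue measure does the rest. *)
Lemma integral_layer (a y : R) : 0 < a -> gam + 2 != 0 ->
  (\int[leb]_s (expR (gam * s) * phi (a * expR s) y)%:E =
   (a `^ (- gam) * `|y| `^ (gam + 2))%:E * J)%E.
Proof.
move=> a0 g0.
have [->|y0] := eqVneq y 0.
  rewrite normr0 powR0// mulr0 mul0e.
  by apply: integral0_eq => s _; rewrite phi0 ?mulr0// mulr_gt0 ?expR_gt0.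
have ny0 : 0 < `|y| by rewrite normr_gt0.
pose L := ln (a / `|y|).
have eL : expR L = a / `|y| by rewrite /L lnK// posrE divr_gt0.
transitivity (\int[leb]_s ((a `^ (- gam) * `|y| `^ (gam + 2))%:E *
    (expR (gam * ((s : R) + L)) * phi (expR ((s : R) + L)) 1)%:E))%E.
  apply: eq_integral => s _; rewrite -EFinM; congr EFin.
  have -> : phi (a * expR s) y = `|y| ^+ 2 * phi (expR (s + L)) 1.
    rewrite -phi_norm ?mulr_gt0 ?expR_gt0// -phi_scale ?expR_gt0//.
    rewrite mulr1 expRD eL; congr (phi _ _).
    by field; rewrite gt_eqF.
  have -> : expR (gam * (s + L)) = expR (gam * s) * (a `^ gam * `|y| `^ (- gam)).
    rewrite mulrDr expRD; congr (_ * _).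
    rewrite /powR !gt_eqF// -expRD /L ln_div ?posrE//; congr expR; ring.
  have ag : a `^ (- gam) * a `^ gam = 1.
    by rewrite -powRD ?addNr ?powRr0// (gt_eqF a0) implybT.
  have yg : `|y| `^ (gam + 2) * `|y| `^ (- gam) = `|y| ^+ 2.
    rewrite -powRD; last by rewrite (gt_eqF ny0) implybT.
    by rewrite (_ : gam + 2 + - gam = 2%:R) ?powR_mulrn//; ring.
  move: (a `^ gam) (a `^ - gam) (`|y| `^ _) (`|y| `^ _) (phi _ 1) ag yg.
  by move=> A A' Y Y' f ag <-; rewrite -[LHS]mul1r -ag; ring.
rewrite ge0_integralZl//; last first.
- by rewrite lee_fin mulr_ge0 ?powR_ge0.
- by move=> s _; rewrite lee_fin mulr_ge0 ?expR_ge0 ?phi_ge0 ?expR_gt0.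
- have mL : measurable_fun [set: R] (fun s => s + L) by exact: measurable_funD.
  have := @measurable_layer _ _ 1 _ (cst 1) mL (@measurable_cst _ _ _ _ _ _).
  by under eq_fun do rewrite mul1r.
congr (_ * _)%E.
rewrite (@ge0_integral_shift _ L (fun s => (expR (gam * s) * phi (expR s) 1)%:E))//.
- have := @measurable_layer _ _ 1 idfun (cst 1) (@measurable_id _ _ _)
    (@measurable_cst _ _ _ _ _ _).
  by under eq_fun do rewrite mul1r.
- by move=> s; rewrite lee_fin mulr_ge0 ?expR_ge0 ?phi_ge0 ?expR_gt0.
Qed.

(** The hypothesis at level t = e^s, multiplied by e^(gam s) and integrated over
    s, becomes the conclusion by Tonelli's theorem and integral_layer; the
    constant J appears on both sides and cancels. *)
Lemma layer_cake_compare (M a : R) (F f : T -> R) :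
  0 <= M -> 0 < a -> 0 < gam + 2 ->
  (0 < J)%E -> (J < +oo)%E ->
  measurable_fun setT F -> measurable_fun setT f ->
  (forall t, 0 < t -> (\int[mu]_x (phi t (F x))%:E
                       <= M%:E * \int[mu]_x (phi (a * t) (f x))%:E)%E) ->
  (\int[mu]_x (`|F x| `^ (gam + 2))%:E
   <= (M * a `^ (- gam))%:E * \int[mu]_x (`|f x| `^ (gam + 2))%:E)%E.
Proof.
move=> M0 a0 g0 J0 Joo mF mf Ff.
have mphi1 t (h : T -> R) : measurable_fun setT h ->
    measurable_fun setT (fun x : T => (phi t (h x))%:E).
  move=> mh; apply/measurable_EFinP.
  by apply: (measurableT_comp mphi (g := fun x => (t, h x))); exact: measurable_fun_pair.
have mpow (h : T -> R) : measurable_fun setT h ->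
    measurable_fun setT (fun x : T => (`|h x| `^ (gam + 2))%:E).
  move=> mh; apply/measurable_EFinP.
  apply: (measurableT_comp (measurable_powR _)).
  exact: (measurableT_comp (@normr_measurable R _)).
(* b = 1 will be used for F, and b = a for f *)
have swap (b : R) (h : T -> R) : 0 < b -> measurable_fun setT h ->
   (\int[leb]_s ((expR (gam * s))%:E * \int[mu]_x (phi (b * expR s) (h x))%:E) =
    (b `^ (- gam))%:E * (\int[mu]_x (`|h x| `^ (gam + 2))%:E) * J)%E.
  move=> b0 mh.
  transitivity (\int[leb]_s \int[mu]_x (expR (gam * s) * phi (b * expR s) (h x))%:E)%E.
    apply: eq_integral => s _; under [RHS]eq_integral do rewrite EFinM.
    rewrite ge0_integralZl//.
    - exact: mphi1.
    - by move=> x _; rewrite lee_fin phi_ge0// mulr_gt0// expR_gt0.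
  rewrite (@fubini_tonelli _ _ _ _ _ leb mu
    (fun z => (expR (gam * z.1) * phi (b * expR z.1) (h z.2))%:E))/=.
  - under eq_integral do rewrite integral_layer// ?gt_eqF//.
    rewrite ge0_integralZr//.
    + under eq_integral do rewrite EFinM.
      rewrite ge0_integralZl//; first exact: mpow.
      + by rewrite lee_fin powR_ge0.
    + apply/measurable_EFinP; apply: measurable_funM => //.
      exact/measurable_EFinP/mpow.
    + by move=> x _; rewrite lee_fin mulr_ge0// powR_ge0.
    + exact: ltW.
  - apply: (@measurable_layer _ _ b fst (h \o snd)) => //.
    exact: (measurableT_comp mh).
  - by move=> z; rewrite lee_fin mulr_ge0 ?expR_ge0 ?phi_ge0// mulr_gt0 ?expR_gt0.
have Jr : J = (fine J)%:E by rewrite fineK// ge0_fin_numE// ltW.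
have j0 : 0 < fine J by rewrite fine_gt0// J0 Joo.
rewrite -(@lee_pmul2r _ (fine J)%:E)//.
rewrite -Jr.
have := @swap 1 F ltr01 mF; rewrite powR1 mul1e => <-.
rewrite EFinM -!muleA (muleA (a `^ _)%:E) -(swap a f a0 mf).
have mint b (h : T -> R) : 0 < b -> measurable_fun setT h ->
   measurable_fun [set: R] (fun s =>
     (expR (gam * s))%:E * \int[mu]_x (phi (b * expR s) (h x))%:E)%E.
  move=> b0 mh; apply: emeasurable_funM.
    apply/measurable_EFinP; apply: (measurableT_comp (@measurable_expR R)).
    exact: measurable_funM.
  apply: (@measurable_fun_fubini_tonelli_F _ _ _ _ _ mu
    (fun z => (phi (b * expR z.1) (h z.2))%:E)).
  - apply/measurable_EFinP.
    apply: (measurableT_comp mphi (g := fun z : R * T => (b * expR z.1, h z.2))).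
    apply: measurable_fun_pair; last exact: (measurableT_comp mh).
    apply: measurable_funM => //.
    exact: (measurableT_comp (@measurable_expR R)).
  - by move=> z; rewrite lee_fin phi_ge0// mulr_gt0// expR_gt0.
have ige0 b (h : T -> R) s : 0 < b -> (0 <= \int[mu]_x (phi (b * expR s) (h x))%:E)%E.
  by move=> b0; apply: integral_ge0 => x _; rewrite lee_fin phi_ge0// mulr_gt0// expR_gt0.
rewrite -ge0_integralZl//; last 2 first.
- exact: mint.
- by move=> s _; rewrite mule_ge0 ?lee_fin ?expR_ge0 ?ige0.
apply: ge0_le_integral => //.
- by move=> s _; rewrite mule_ge0 ?lee_fin ?expR_ge0 ?ige0.
- exact: mint.
- by apply: measurable_funeM; exact: mint.
- move=> s _; rewrite muleCA lee_wpmul2l ?lee_fin ?expR_ge0//.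
  by rewrite mul1r Ff ?expR_gt0.
Qed.

Lemma layer_weight_lty (b C : R) : 0 < b -> 0 <= C ->
  (forall s, expR (gam * s) * phi (expR s) 1 <= C * expR (- b * `|s|)) ->
  (J < +oo)%E.
Proof.
move=> b0 C0 le_.
apply: (@le_lt_trans _ _ (\int[leb]_s (C%:E * (expR (- b * `|s|))%:E))%E).
  apply: ge0_le_integral => //.
  - by move=> s _; rewrite lee_fin mulr_ge0 ?expR_ge0 ?phi_ge0 ?expR_gt0.
  - have := @measurable_layer _ _ 1 idfun (cst 1) (@measurable_id _ _ _)
    (@measurable_cst _ _ _ _ _ _).
    by under eq_fun do rewrite mul1r.
  - apply: measurable_funeM; apply/measurable_EFinP.
    apply: (measurableT_comp (@measurable_expR R)).
    by apply: measurable_funM => //; exact: (@normr_measurable R).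
  - by move=> s _; rewrite -EFinM lee_fin.
rewrite ge0_integralZl//.
- by rewrite lte_mul_pinfty ?lee_fin// integral_expR_Nabs_lty.
- apply/measurable_EFinP; apply: (measurableT_comp (@measurable_expR R)).
  by apply: measurable_funM => //; exact: (@normr_measurable R).
Qed.

(** Only positivity of J matters, so a bound from below on one interval of levels
    suffices; on [-2, -1] the level e^s is less than 1, where the functions phi
    used below do not vanish at 1. *)
Lemma layer_weight_gt0 (c : R) : 0 < c ->
  (forall s, -2 <= s <= -1 -> c <= expR (gam * s) * phi (expR s) 1) ->
  (0 < J)%E.
Proof.
move=> c0 le_.
apply: (@lt_le_trans _ _ (\int[leb]_(s in `[(-2)%R, (-1)%R]%classic) c%:E)%E).
  rewrite integral_cst//= lebesgue_measure_itv/= lte_fin.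
  by rewrite ifT; [rewrite -EFinD -EFinM lte_fin mulr_gt0//; lra | lra].
have mJ : measurable_fun [set: R] (fun s => (expR (gam * s) * phi (expR s) 1)%:E).
  have := @measurable_layer _ _ 1 idfun (cst 1) (@measurable_id _ _ _)
    (@measurable_cst _ _ _ _ _ _).
  by under eq_fun do rewrite mul1r.
have J0 s : (0 <= (expR (gam * s) * phi (expR s) 1)%:E)%E.
  by rewrite lee_fin mulr_ge0 ?expR_ge0 ?phi_ge0 ?expR_gt0.
apply: (@le_trans _ _ (\int[leb]_(s in `[(-2)%R, (-1)%R]%classic)
   (expR (gam * s) * phi (expR s) 1)%:E)%E).
  apply: ge0_le_integral => //.
  - by move=> s _; rewrite lee_fin ltW.
  - exact: measurable_funTS.
by apply: ge0_subset_integral.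
Qed.

End layer_cake.

(** * Interpolation inequalities *)

Section interpolation.
Context d (T : measurableType d) {R : realType}.
Variable mu : {sigma_finite_measure set T -> \bar R}.
Implicit Types (p : R) (F f : T -> R).

Let measurable_clip_comp t f : measurable_fun setT f ->
  measurable_fun setT (fun x => clip t (f x)).
Proof.
move=> mf; apply: (measurableT_comp measurable_clip (g := fun x => (t, f x))).
exact: measurable_fun_pair.
Qed.

Let measurable_huber : measurable_fun setT (fun z : R * R => huber z.1 z.2).
Proof.
apply: measurable_funD; first by apply: measurable_funX; exact: measurable_clip.
apply: measurable_funM.
  by apply: measurable_funM => //; exact: measurable_fst.
apply: (measurableT_comp (@normr_measurable R _)).
by apply: measurable_funB; [exact: measurable_snd|exact: measurable_clip].
Qed.

Let measurable_excess2 : measurable_fun setT (fun z : R * R => excess2 z.1 z.2).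
Proof.
apply: measurable_funX.
by apply: measurable_funB; [exact: measurable_snd|exact: measurable_clip].
Qed.

Lemma huber_layer_cake p F f (M a : R) : 1 < p < 2 -> 0 <= M -> 0 < a ->
  measurable_fun setT F -> measurable_fun setT f ->
  (forall t, 0 < t -> (\int[mu]_x (huber t (F x))%:E
                       <= M%:E * \int[mu]_x (huber (a * t) (f x))%:E)%E) ->
  (\int[mu]_x (`|F x| `^ p)%:E
   <= (M * a `^ (2 - p))%:E * \int[mu]_x (`|f x| `^ p)%:E)%E.
Proof.
move=> /andP[p1 p2] M0 a0 mF mf Ff.
have [g gE] : exists g : R, p = g + 2 by exists (p - 2); ring.
have -> : 2 - p = - g by rewrite gE; ring.
rewrite gE.
have h0 (t y : R) : 0 < t -> 0 <= huber t y.
  by move=> t0; rewrite addr_ge0 ?sqr_ge0// mulr_ge0// mulr_ge0// ltW.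
have hexp (s : R) : s <= 0 -> huber (expR s) 1 = expR s * (2 - expR s).
  move=> s0; rewrite /huber; have := expR_ge0 s => es0.
  have es1 : expR s <= 1 by rewrite -expR0 ler_expR.
  by case: (clipP 1 es0) => [h1 h2|h|h]; rewrite ?ger0_norm; try nra; lra.
have hexp1 (s : R) : 0 <= s -> huber (expR s) 1 = 1.
  move=> s0; rewrite /huber; have := expR_ge0 s => es0.
  have es1 : 1 <= expR s by rewrite -expR0 ler_expR.
  case: (clipP 1 es0) => [h1 h2|h|h]; last by lra.
    by rewrite subrr normr0 mulr0 addr0 expr1n.
  by lra.
apply: (@layer_cake_compare _ _ _ mu huber g) => //.
- by move=> t t0; rewrite /huber; case: (clipP 0 (ltW t0)); rewrite ?subr0 ?normr0; lra.
- move=> t y t0; case: (leP 0 y) => y0; first by rewrite ger0_norm.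
  by rewrite ltr0_norm// /huber clipN ?ltW// sqrrN -opprD normrN.
- move=> c t y c0 t0; rewrite /huber clip_scale// -mulrBr normrM (gtr0_norm c0); ring.
- by lra.
- apply: (@layer_weight_gt0 _ _ _ _ _ (expR (- 2))) => //.
  move=> s /andP[s2 s1].
  rewrite hexp; last by lra.
  have e1 : expR s <= 1 by rewrite -expR0 ler_expR; lra.
  have e2 : expR (- 2) <= expR s by rewrite ler_expR.
  have e3 : 1 <= expR (g * s) by rewrite -expR0 ler_expR; nra.
  have e0 := expR_gt0 s.
  apply: (@le_trans _ _ (expR s * (2 - expR s))); first by nra.
  by rewrite ler_peMl// mulr_ge0 ?ltW//; lra.
- (* huber (e^s) 1 is 1 for s >= 0 and at most 2 e^s for s <= 0, so that the
     integrand decays at rate 2 - p at +oo and p - 1 at -oo *)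
  have [b [b0 bp b2]] : exists b, [/\ 0 < b, b <= p - 1 & b <= 2 - p].
    exists (Num.min (p - 1) (2 - p)); split; last 2 first.
    - by rewrite ge_min lexx.
    - by rewrite ge_min lexx orbT.
    by rewrite lt_min; apply/andP; split; lra.
  apply: (@layer_weight_lty _ _ _ _ _ b 2) => // s.
  have [s0|s0] := leP 0 s.
    rewrite hexp1// mulr1 ger0_norm//.
    have : expR (g * s) <= expR (- b * s) by rewrite ler_expR; nra.
    have := expR_ge0 (- b * s); lra.
  rewrite (hexp _ (ltW s0)) ltr0_norm//.
  apply: (@le_trans _ _ (2 * expR ((g + 1) * s))).
    rewrite [in leRHS](_ : (g + 1) * s = g * s + s); last by ring.
    rewrite expRD mulrA (mulrC (expR _)) mulrAC -!mulrA mulrA.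
    have := expR_ge0 s. have := expR_ge0 (g * s).
    set e := expR s; set q := expR _ => q0 e0.
    have : 0 <= e * q by rewrite mulr_ge0.
    nra.
  rewrite ler_pM2l// ler_expR; nra.
Qed.

Lemma excess2_layer_cake p F f (M a : R) : 2 < p -> 0 <= M -> 0 < a ->
  measurable_fun setT F -> measurable_fun setT f ->
  (forall t, 0 < t -> (\int[mu]_x (excess2 t (F x))%:E
                       <= M%:E * \int[mu]_x (excess2 (a * t) (f x))%:E)%E) ->
  (\int[mu]_x (`|F x| `^ p)%:E
   <= (M * a `^ (2 - p))%:E * \int[mu]_x (`|f x| `^ p)%:E)%E.
Proof.
move=> p2 M0 a0 mF mf Ff.
have [g gE] : exists g : R, p = g + 2 by exists (p - 2); ring.
have -> : 2 - p = - g by rewrite gE; ring.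
rewrite gE.
have hexp (s : R) : s <= 0 -> excess2 (expR s) 1 = (1 - expR s) ^+ 2.
  move=> s0; rewrite /excess2; have := expR_ge0 s => es0.
  have es1 : expR s <= 1 by rewrite -expR0 ler_expR.
  by case: (clipP 1 es0) => [h1 h2|h|h]; try nra.
have hexp1 (s : R) : 0 <= s -> excess2 (expR s) 1 = 0.
  move=> s0; rewrite /excess2; have := expR_ge0 s => es0.
  have es1 : 1 <= expR s by rewrite -expR0 ler_expR.
  by case: (clipP 1 es0) => [h1 h2|h|h]; try lra.
apply: (@layer_cake_compare _ _ _ mu excess2 g) => //.
- by move=> t y _; exact: sqr_ge0.
- by move=> t t0; rewrite /excess2; case: (clipP 0 (ltW t0)); lra.
- move=> t y t0; case: (leP 0 y) => y0; first by rewrite ger0_norm.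
  by rewrite ltr0_norm// /excess2 clipN ?ltW// -opprD sqrrN.
- by move=> c t y c0 t0; rewrite /excess2 clip_scale// -mulrBr exprMn.
- by lra.
- have e1 : expR (- 1) < 1 :> R by rewrite expR_lt1; lra.
  apply: (@layer_weight_gt0 _ _ _ _ _ (expR (g * (- 2)) * (1 - expR (- 1)) ^+ 2)) => //.
  + by move=> t y _; exact: sqr_ge0.
  + by rewrite mulr_gt0 ?expR_gt0// exprn_gt0//; lra.
  + move=> s /andP[s2 s1].
    rewrite hexp; last by lra.
    apply: ler_pM; rewrite ?expR_ge0 ?sqr_ge0 ?ler_expR//; first by nra.
    have es : expR s <= expR (- 1) by rewrite ler_expR.
    by nra.
- apply: (@layer_weight_lty _ _ _ _ _ g 1) => //.
  + by move=> t y _; exact: sqr_ge0.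
  + by lra.
  + move=> s; have [s0|s0] := leP 0 s.
      by rewrite hexp1// mulr0 mul1r expR_ge0.
    rewrite (hexp _ (ltW s0)) ltr0_norm// mul1r mulrNN.
    rewrite ler_piMr ?expR_ge0//.
    have e1 : expR s <= 1 by rewrite -expR0 ler_expR ltW.
    have := expR_ge0 s; nra.
Qed.

(** F stands for the image of f under an operator whose squared norm on L^2 is m2
    and whose norm on L^1 is m1, A and B for the images of the two parts of f.
    The level m1 / m2 * t at which f is cut makes m2 a common factor of the bounds
    on the two parts of huber t F. *)
Lemma interpolation_L1_L2_gt0 p F f (m1 m2 : R) : 1 < p < 2 -> 0 < m1 -> 0 < m2 ->
  measurable_fun setT F -> measurable_fun setT f ->
  (forall t, 0 < t -> exists A B : T -> R,
    [/\ measurable_fun setT A, measurable_fun setT B, F = A \+ B %[ae mu],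
       (\int[mu]_x (A x ^+ 2)%:E <= m2%:E * \int[mu]_x (clip t (f x) ^+ 2)%:E)%E
     & (\int[mu]_x `|B x|%:E <= m1%:E * \int[mu]_x `|f x - clip t (f x)|%:E)%E]) ->
  (\int[mu]_x (`|F x| `^ p)%:E
   <= (m1 `^ (2 - p) * m2 `^ (p - 1))%:E * \int[mu]_x (`|f x| `^ p)%:E)%E.
Proof.
move=> p12 m10 m20 mF mf dec.
have -> : m1 `^ (2 - p) * m2 `^ (p - 1) = m2 * (m1 / m2) `^ (2 - p).
  rewrite powRM ?invr_ge0 ?ltW// mulrCA; congr (_ * _).
  rewrite -powR_inv1 ?ltW// -powRrM -[X in _ = X * _]powRr1 ?ltW// -powRD; last first.
    by rewrite (gt_eqF m20) implybT.
  by congr (_ `^ _); ring.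
apply: huber_layer_cake => //; [exact: ltW|exact: divr_gt0|move=> t t0].
have t1 : 0 < m1 / m2 * t by rewrite mulr_gt0// divr_gt0.
have [A [B [mA mB FAB A2 B1]]] := dec _ t1.
have mc := measurable_clip_comp (m1 / m2 * t) mf.
have mfc : measurable_fun setT (fun x => `|f x - clip (m1 / m2 * t) (f x)|).
  by apply: (measurableT_comp (@normr_measurable R _)); exact: measurable_funB.
have mBn : measurable_fun setT (fun x => `|B x|).
  exact: (measurableT_comp (@normr_measurable R _)).
apply: (@le_trans _ _ (\int[mu]_x ((A x ^+ 2)%:E + (2 * t)%:E * `|B x|%:E))%E).
  apply: ae_ge0_le_integral => //.
  - by move=> x _; rewrite lee_fin addr_ge0 ?sqr_ge0// !mulr_ge0// ltW.
  - apply/measurable_EFinP.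
    apply: (measurableT_comp measurable_huber (g := fun x => (t, F x))).
    exact: measurable_fun_pair.
  - by move=> x _; rewrite -EFinM -EFinD lee_fin addr_ge0 ?sqr_ge0// !mulr_ge0// ltW.
  - apply: emeasurable_funD; last apply: measurable_funeM.
      by apply/measurable_EFinP; exact: measurable_funX.
    exact/measurable_EFinP.
  - apply: filterS FAB => x /(_ I) /= -> _.
    by rewrite -EFinM -EFinD lee_fin huber_split// ltW.
have t20 : (0 <= (2 * t)%:E)%E by rewrite lee_fin mulr_ge0// ltW.
rewrite ge0_integralD//; last 4 first.
- by move=> x _; rewrite lee_fin sqr_ge0.
- by apply/measurable_EFinP; exact: measurable_funX.
- by move=> x _; rewrite mule_ge0.
- by apply: measurable_funeM; exact/measurable_EFinP.
rewrite ge0_integralZl//; last by exact/measurable_EFinP.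
apply: (@le_trans _ _ (m2%:E * \int[mu]_x (clip (m1 / m2 * t) (f x) ^+ 2)%:E
   + m2%:E * ((2 * (m1 / m2 * t))%:E * \int[mu]_x (`|f x - clip (m1 / m2 * t) (f x)|)%:E))%E).
  apply: leeD => //.
  apply: (le_trans (lee_wpmul2l t20 B1)).
  rewrite !muleA -!EFinM.
  suff -> : 2 * t * m1 = m2 * (2 * (m1 / m2 * t)) by [].
  by field; rewrite gt_eqF.
rewrite -ge0_muleDr//; last 2 first.
- by apply: integral_ge0 => x _; rewrite lee_fin sqr_ge0.
- apply: mule_ge0; first by rewrite lee_fin; apply: mulr_ge0 => //; exact: ltW.
  by apply: integral_ge0 => x _; rewrite lee_fin.
apply: lee_wpmul2l; first by rewrite lee_fin ltW.
rewrite -ge0_integralZl//; last 2 first.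
- exact/measurable_EFinP.
- by rewrite lee_fin mulr_ge0// ltW.
rewrite -ge0_integralD//.
- by move=> x _; rewrite lee_fin sqr_ge0.
- by apply/measurable_EFinP; exact: measurable_funX.
- by move=> x _; rewrite -EFinM lee_fin mulr_ge0// mulr_ge0// ltW.
- by apply: measurable_funeM; exact/measurable_EFinP.
Qed.

(** The case m2 = 0 is a limit: the hypothesis persists for every positive value
    of m2, and the bound then tends to 0. *)
Lemma interpolation_L1_L2 p F f (m1 m2 : R) : 1 < p < 2 -> 0 < m1 -> 0 <= m2 ->
  measurable_fun setT F -> measurable_fun setT f ->
  (\int[mu]_x (`|f x| `^ p)%:E < +oo)%E ->
  (forall t, 0 < t -> exists A B : T -> R,
    [/\ measurable_fun setT A, measurable_fun setT B, F = A \+ B %[ae mu],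
       (\int[mu]_x (A x ^+ 2)%:E <= m2%:E * \int[mu]_x (clip t (f x) ^+ 2)%:E)%E
     & (\int[mu]_x `|B x|%:E <= m1%:E * \int[mu]_x `|f x - clip t (f x)|%:E)%E]) ->
  (\int[mu]_x (`|F x| `^ p)%:E
   <= (m1 `^ (2 - p) * m2 `^ (p - 1))%:E * \int[mu]_x (`|f x| `^ p)%:E)%E.
Proof.
move=> p12 m10; rewrite le_eqVlt => /predU1P[<-|m20] mF mf foo dec; last first.
  exact: interpolation_L1_L2_gt0.
have p1 : 0 < p - 1 by case/andP: p12 => *; lra.
rewrite powR0 ?gt_eqF// mulr0 mul0e.
set N := (\int[mu]_x (`|f x| `^ p)%:E)%E in foo *.
have N0 : (0 <= N)%E by apply: integral_ge0 => x _; rewrite lee_fin powR_ge0.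
have NE : N = (fine N)%:E by rewrite fineK// ge0_fin_numE.
have n0 : 0 <= fine N by exact: fine_ge0.
apply/lee_addgt0Pr => e e0; rewrite add0e.
pose c := m1 `^ (2 - p) * fine N + 1.
have c0 : 0 < c by rewrite ltr_wpDl// mulr_ge0// powR_ge0.
(* chosen so that m1^(2-p) * eps^(p-1) * fine N <= e *)
pose eps := (e / c) `^ (p - 1)^-1.
have ec0 : 0 < e / c by rewrite divr_gt0.
have eps0 : 0 < eps by rewrite powR_gt0.
have := @interpolation_L1_L2_gt0 p F f m1 eps p12 m10 eps0 mF mf.
rewrite -/N NE -EFinM => /(_ _)/le_trans; apply.
  move=> t /dec[A [B [mA mB FAB A2 B1]]]; exists A, B; split => //.
  rewrite mul0e in A2; apply: (le_trans A2).
  apply: mule_ge0; first by rewrite lee_fin ltW.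
  by apply: integral_ge0 => x _; rewrite lee_fin sqr_ge0.
rewrite lee_fin /eps -powRrM mulVf ?gt_eqF// (powRr1 (ltW ec0)).
rewrite mulrAC mulrA ler_pdivrMr// mulrC ler_pM2l// /c.
by rewrite lerDl.
Qed.

(** Here m is the norm on L^oo and m2 the squared norm on L^2: cutting f at height
    t / m makes |A| <= t, and then excess2 t F is at most B^2. *)
Lemma interpolation_L2_Loo p F f (m m2 : R) : 2 < p -> 0 < m -> 0 <= m2 ->
  measurable_fun setT F -> measurable_fun setT f ->
  (forall t, 0 < t -> exists A B : T -> R,
    [/\ measurable_fun setT B, F = A \+ B %[ae mu],
       {ae mu, forall x, `|A x| <= m * t}
     & (\int[mu]_x (B x ^+ 2)%:E <= m2%:E * \int[mu]_x ((f x - clip t (f x)) ^+ 2)%:E)%E]) ->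
  (\int[mu]_x (`|F x| `^ p)%:E
   <= (m `^ (p - 2) * m2)%:E * \int[mu]_x (`|f x| `^ p)%:E)%E.
Proof.
move=> p2 m0 m20 mF mf dec.
have -> : m `^ (p - 2) * m2 = m2 * (m^-1) `^ (2 - p).
  rewrite mulrC; congr (_ * _).
  by rewrite -powR_inv1 ?ltW// -powRrM; congr (_ `^ _); ring.
have mi0 : 0 < m^-1 by rewrite invr_gt0.
apply: excess2_layer_cake => // t t0.
have t1 : 0 < m^-1 * t by rewrite mulr_gt0.
have [A [B [mB FAB Am B2]]] := dec _ t1.
apply: le_trans B2.
apply: ae_ge0_le_integral => //.
- by move=> x _; rewrite lee_fin sqr_ge0.
- apply/measurable_EFinP.
  apply: (measurableT_comp measurable_excess2 (g := fun x => (t, F x))).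
  exact: measurable_fun_pair.
- by move=> x _; rewrite lee_fin sqr_ge0.
- by apply/measurable_EFinP; exact: measurable_funX.
- apply: filterS2 FAB Am => x /(_ I) /= -> Am _.
  rewrite lee_fin excess2_split//.
  by rewrite mulrA divff ?gt_eqF// mul1r in Am.
Qed.

End interpolation.

(** * Markov operators with an invariant distribution *)

Section markov_operator.
Context d (T : measurableType d) {R : realType}.
Variables (K : R.-pker T ~> T) (pi : probability T R).
Hypothesis hpi : invariant_distribution K pi.
Implicit Types f g h : T -> R.

(** Invariance extends from indicators to nonnegative functions because pi K is
    a composition of kernels, over which the integral is known to iterate. *)
Lemma ge0_integral_invariant (g : T -> \bar R) :
  measurable_fun setT g -> (forall x, 0 <= g x)%E ->
  (\int[pi]_x \int[K x]_y g y = \int[pi]_x g x)%E.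
Proof.
move=> mg g0.
pose l := kprobability (measurable_cst (pi : pprobability T R)
  : measurable_fun [set: T] (cst (pi : pprobability T R))).
have := @integral_kcomp _ _ _ T T T R l (kernel.kernel_snd K) point g g0 mg.
rewrite /= => <-; apply: eq_measure_integral => A mA _.
by rewrite -[RHS](hpi mA).
Qed.

(** A pi-null set is K x-null for pi-almost every x, since the integral of K x N
    over x is pi N. *)
Lemma ae_kernel (P : T -> Prop) : {ae pi, forall y, P y} ->
  {ae pi, forall x, {ae K x, forall y, P y}}.
Proof.
move=> [N [mN piN PN]].
have mKN : measurable_fun setT (fun x => K x N) by exact: measurable_kernel.
have /(ae_eq_integral_abs pi measurableT mKN) : (\int[pi]_x `|K x N| = 0)%E.
  by under eq_integral do rewrite gee0_abs//; rewrite hpi.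
by apply: filterS => x /(_ I) KN; exists N.
Qed.

Lemma measurable_markov_op f : measurable_fun setT f ->
  measurable_fun setT (markov_op K f).
Proof.
move=> mf; apply: (measurableT_comp (fine_measurable _)) => //.
under eq_fun do rewrite integralE.
have mef : measurable_fun setT (EFin \o f) by exact/measurable_EFinP.
by apply: emeasurable_funB; apply: measurable_fun_integral_kernel => //;
  solve [exact: measurable_kernel | exact: measurable_funepos | exact: measurable_funeneg].
Qed.

Lemma integrable_kernel (g : T -> \bar R) : pi.-integrable setT g ->
  {ae pi, forall x, (K x).-integrable setT g}.
Proof.
move=> ig; have mg := measurable_int _ ig.
have mag : measurable_fun setT (fun x => `|g x|%E) by exact: measurableT_comp.
have mKg : measurable_fun setT (fun x => \int[K x]_y `|g y|)%E.
  by apply: measurable_fun_integral_kernel => // U mU; exact: measurable_kernel.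
have : pi.-integrable setT (fun x => \int[K x]_y `|g y|)%E.
  apply/integrableP; split => //.
  under eq_integral do rewrite gee0_abs ?integral_ge0//.
  by rewrite ge0_integral_invariant//; case/integrableP: ig.
move/(integrable_ae measurableT); apply: filterS => x /(_ I) fx.
by apply/integrableP; split => //; rewrite -ge0_fin_numE ?integral_ge0.
Qed.


Local Notation intg f := (pi.-integrable setT (EFin \o f)).

Lemma le_normr_markov_op f x : (K x).-integrable setT (EFin \o f) ->
  (`|markov_op K f x|%:E <= \int[K x]_y `|f y|%:E)%E.
Proof.
move=> fi; apply: (@le_trans _ _ (\int[K x]_y `|f y|)%:E).
  by rewrite lee_fin; exact: le_normr_Rintegral.
rewrite /Rintegral fineK//.
rewrite ge0_fin_numE; last by apply: integral_ge0.
by case/integrableP: fi.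
Qed.

Lemma L1_markov_op_le f : intg f ->
  (\int[pi]_x `|markov_op K f x|%:E <= \int[pi]_x `|f x|%:E)%E.
Proof.
move=> fi; have /measurable_EFinP mf := measurable_int _ fi.
have mnf : measurable_fun setT (fun x => `|f x|%:E).
  by apply/measurable_EFinP; exact: measurableT_comp.
rewrite -(ge0_integral_invariant mnf)//.
apply: ae_ge0_le_integral => //.
- by apply/measurable_EFinP; apply: measurableT_comp => //; exact: measurable_markov_op.
- by move=> x _; apply: integral_ge0 => y _; rewrite lee_fin.
- by apply: measurable_fun_integral_kernel => //; exact: measurable_kernel.
- by apply: filterS (integrable_kernel fi) => x fx _; exact: le_normr_markov_op.
Qed.

Lemma integrable_markov_op f : intg f -> intg (markov_op K f).
Proof.
move=> fi; have /measurable_EFinP mf := measurable_int _ fi.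
apply/integrableP; split; first by apply/measurable_EFinP; exact: measurable_markov_op.
by apply: le_lt_trans (L1_markov_op_le fi) _; case/integrableP: fi.
Qed.

(** The positive and negative parts are treated separately; both have finite
    integrals, so that the difference is meaningful. *)
Lemma Rintegral_markov_op f : intg f ->
  \int[pi]_x markov_op K f x = \int[pi]_x f x.
Proof.
move=> fi; have mf := measurable_int _ fi.
have mK (g : T -> \bar R) : measurable_fun setT g -> (forall x, 0 <= g x)%E ->
    measurable_fun setT (fun x => \int[K x]_y g y)%E.
  by move=> mg g0; apply: measurable_fun_integral_kernel => //; exact: measurable_kernel.
have iK (g : T -> \bar R) : pi.-integrable setT g -> (forall x, 0 <= g x)%E ->
    pi.-integrable setT (fun x => \int[K x]_y g y)%E.
  move=> /integrableP[mg gi] g0; apply/integrableP; split; first exact: mK.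
  under eq_integral do rewrite gee0_abs ?integral_ge0//.
  rewrite ge0_integral_invariant//.
  by move: gi; under eq_integral do rewrite gee0_abs//.
rewrite /Rintegral; congr fine.
transitivity (\int[pi]_x ((\int[K x]_y (EFin \o f)^\+ y) - (\int[K x]_y (EFin \o f)^\- y)))%E.
  apply: ae_eq_integral => //.
  - exact: (measurable_int _ (integrable_markov_op fi)).
  - by apply: emeasurable_funB; apply: mK => //;
      solve [exact: measurable_funepos | exact: measurable_funeneg].
  - apply: filterS (integrable_kernel fi) => x fx _ /=.
    by rewrite -integralE /markov_op /Rintegral fineK//; exact: integrable_fin_num.
rewrite integralB//; last 2 first.
- by apply: iK => //; exact: integrable_funepos.
- by apply: iK => //; exact: integrable_funeneg.
rewrite !ge0_integral_invariant//; last 2 first.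
- exact: measurable_funeneg.
- exact: measurable_funepos.
by rewrite -integralE.
Qed.

Lemma ae_eq_markov_op f g : measurable_fun setT f -> measurable_fun setT g ->
  f = g %[ae pi] -> markov_op K f = markov_op K g %[ae pi].
Proof.
move=> mf mg fg.
have /ae_kernel : {ae pi, forall y, f y = g y} by apply: filterS fg => x /(_ I).
apply: filterS => x fgx _; rewrite /markov_op /Rintegral; congr fine.
apply: ae_eq_integral => //; [exact/measurable_EFinP|exact/measurable_EFinP|].
by apply: filterS fgx => y /= ->.
Qed.

Lemma markov_opD f g : intg f -> intg g ->
  markov_op K (f \+ g) = markov_op K f \+ markov_op K g %[ae pi].
Proof.
move=> fi gi; apply: filterS2 (integrable_kernel fi) (integrable_kernel gi).
by move=> x fx gx _; rewrite /markov_op/= RintegralD.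
Qed.

Lemma markov_opB f g : intg f -> intg g ->
  markov_op K (f \- g) = markov_op K f \- markov_op K g %[ae pi].
Proof.
move=> fi gi; apply: filterS2 (integrable_kernel fi) (integrable_kernel gi).
by move=> x fx gx _; rewrite /markov_op/= RintegralB.
Qed.

Lemma markov_opZ (k : R) f : intg f ->
  markov_op K (fun x => k * f x) = (fun x => k * markov_op K f x) %[ae pi].
Proof.
move=> fi; apply: filterS (integrable_kernel fi).
by move=> x fx _; rewrite /markov_op/= RintegralZl.
Qed.

Lemma normr_markov_op_le (c : R) f : measurable_fun setT f ->
  (forall x, `|f x| <= c) -> forall x, `|markov_op K f x| <= c.
Proof.
move=> mf fc x.
have Kx1 : K x setT = 1%E by exact: prob_kernel.
have ci : (\int[K x]_y c%:E)%E = c%:E by rewrite integral_cst//= Kx1 mule1.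
have nfle : (\int[K x]_y `|f y|%:E <= c%:E)%E.
  rewrite -ci; apply: ge0_le_integral => //.
  - by apply/measurable_EFinP; exact: measurableT_comp.
  - by move=> y _; rewrite lee_fin.
have fi : (K x).-integrable setT (EFin \o f).
  apply/integrableP; split; first exact/measurable_EFinP.
  by apply: le_lt_trans nfle _; rewrite ltry.
by rewrite -lee_fin; apply: le_trans (le_normr_markov_op fi) nfle.
Qed.

End markov_operator.

(** * L^p norms as integrals *)

Section Lfun_integral.
Context d (T : measurableType d) {R : realType}.
Variable mu : {measure set T -> \bar R}.
Implicit Types (f : T -> R) (p : R).

Lemma LfunE p f : p != 0 -> (f \in Lfun mu p%:E) <->
  measurable_fun setT f /\ (\int[mu]_x (`|f x| `^ p)%:E < +oo)%E.
Proof.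
move=> p0.
have NE : (\int[mu]_x (`|f x| `^ p)%:E = 'N[mu]_p%:E[EFin \o f] `^ p)%E.
  by rewrite poweR_Lnorm//.
rewrite NE; split.
  rewrite inE => /andP[/[!inE]/= mf Nf]; split => //.
  exact: poweR_lty.
move=> [mf Nf]; rewrite inE; apply/andP; rewrite !inE/=; split => //.
exact: (lty_poweRy p0 Nf).
Qed.

Lemma Lfun2E f : (f \in Lfun mu 2%:E) <->
  measurable_fun setT f /\ (\int[mu]_x (f x ^+ 2)%:E < +oo)%E.
Proof.
rewrite LfunE//.
by under eq_integral do rewrite powR_mulrn// real_normK ?num_real//.
Qed.

Lemma Lnorm2_sqr f :
  (\int[mu]_x (f x ^+ 2)%:E = 'N[mu]_2%:E[EFin \o f] `^ 2)%E.
Proof.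
rewrite poweR_Lnorm//.
by apply: eq_integral => x _ /=; rewrite powR_mulrn// real_normK ?num_real.
Qed.

Lemma ae_eq_Lnorm p f g : measurable_fun setT f -> measurable_fun setT g ->
  f = g %[ae mu] -> ('N[mu]_p%:E[EFin \o f] = 'N[mu]_p%:E[EFin \o g])%E.
Proof.
move=> mf mg fg; rewrite unlock /Lnorm.
have mpow (h : T -> R) : measurable_fun setT h ->
    measurable_fun setT (fun x => (`|h x| `^ p)%:E).
  move=> mh; apply/measurable_EFinP; apply: (measurableT_comp (measurable_powR _)).
  exact: measurableT_comp.
rewrite (ae_eq_integral (fun x => (`|g x| `^ p)%:E) (fun x => (`|f x| `^ p)%:E))//.
- exact: mpow.
- exact: mpow.
- by apply: filterS fg => x /(_ I) /= -> _.
Qed.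

Lemma Lnorm_scale p c f : 0 < p -> measurable_fun setT f ->
  ('N[mu]_p%:E[EFin \o (fun x => c * f x)%R] = `|c|%:E * 'N[mu]_p%:E[EFin \o f])%E.
Proof.
move=> p0 mf; rewrite unlock /Lnorm.
under eq_integral do rewrite /= normrM powRM// EFinM.
rewrite ge0_integralZl//; last first.
  apply/measurable_EFinP; apply: (measurableT_comp (measurable_powR _)).
  exact: measurableT_comp.
rewrite poweRM; last 2 first.
- by rewrite lee_fin powR_ge0.
- by apply: integral_ge0 => x _; rewrite lee_fin powR_ge0.
by rewrite poweR_EFin -powRrM divff ?gt_eqF// powRr1.
Qed.

End Lfun_integral.

(** * Iterates of a Markov operator on L^1, L^2 and L^oo *)

Section markov_iterates.
Context d (T : measurableType d) {R : realType}.
Variables (K : R.-pker T ~> T) (pi : probability T R).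
Hypothesis hpi : invariant_distribution K pi.
Implicit Types f g h : T -> R.
Local Notation intg f := (pi.-integrable setT (EFin \o f)).
Local Notation Kn n f := (iter n (markov_op K) f).

Lemma measurable_iter_markov_op n f : measurable_fun setT f ->
  measurable_fun setT (Kn n f).
Proof. by move=> mf; elim: n => //= n; exact: measurable_markov_op. Qed.

Lemma integrable_iter_markov_op n f : intg f -> intg (Kn n f).
Proof. by move=> fi; elim: n => //= n; exact: (integrable_markov_op hpi). Qed.

Lemma L1_iter_markov_op_le n f : intg f ->
  (\int[pi]_x `|Kn n f x|%:E <= \int[pi]_x `|f x|%:E)%E.
Proof.
move=> fi; elim: n => //= n; apply: le_trans.
by apply: (L1_markov_op_le hpi); exact: integrable_iter_markov_op.
Qed.

Lemma Rintegral_iter_markov_op n f : intg f ->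
  \int[pi]_x Kn n f x = \int[pi]_x f x.
Proof.
move=> fi; elim: n => //= n IH.
by rewrite (Rintegral_markov_op hpi)//; exact: integrable_iter_markov_op.
Qed.

Lemma iter_markov_opD n f g : intg f -> intg g ->
  Kn n (f \+ g) = Kn n f \+ Kn n g %[ae pi].
Proof.
move=> fi gi; elim: n => [|n IH] /=; first by apply: nearW.
have mf := integrable_iter_markov_op n fi.
have mg := integrable_iter_markov_op n gi.
have /measurable_EFinP mff := measurable_int _ fi.
have /measurable_EFinP mgg := measurable_int _ gi.
have mn := measurable_iter_markov_op n.
have := ae_eq_markov_op hpi (mn _ (measurable_funD mff mgg))
  (measurable_funD (mn _ mff) (mn _ mgg)) IH.
by apply: filterS2 (markov_opD hpi mf mg) => x Dx Ex _; rewrite Ex// Dx.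
Qed.

Lemma normr_iter_markov_op_le (c : R) n f : measurable_fun setT f ->
  (forall x, `|f x| <= c) -> forall x, `|Kn n f x| <= c.
Proof.
move=> mf fc; elim: n => //= n IH.
by apply: normr_markov_op_le => //; exact: measurable_iter_markov_op.
Qed.

Variable kappa : R.
Hypothesis kappa_ge0 : 0 <= kappa.
Hypothesis gap : (opnorm_L20 pi K <= kappa%:E)%E.

Lemma sqr_integrable f : measurable_fun setT f ->
  (\int[pi]_x (f x ^+ 2)%:E < +oo)%E -> intg f.
Proof.
move=> mf f2; apply/Lfun1_integrable; apply: Lfun_subset12.
  by rewrite fin_num_measure.
exact/Lfun2E.
Qed.

(** The operator norm is a supremum over the unit ball, so f is normalised first;
    a function of norm zero vanishes almost everywhere, and so does its image. *)
Lemma Lnorm2_markov_op_le f : measurable_fun setT f ->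
  (\int[pi]_x (f x ^+ 2)%:E < +oo)%E -> \int[pi]_x f x = 0 ->
  ('N[pi]_2%:E[EFin \o markov_op K f] <= kappa%:E * 'N[pi]_2%:E[EFin \o f])%E.
Proof.
move=> mf f2 f0; have fi := sqr_integrable mf f2.
have mKf := measurable_markov_op K mf.
have /Lfun2E fL : measurable_fun setT f /\ (\int[pi]_x (f x ^+ 2)%:E < +oo)%E by [].
set N := ('N[pi]_2%:E[EFin \o f])%E.
have N0 : (0 <= N)%E by exact: Lnorm_ge0.
have Noo : (N < +oo)%E by move: fL; rewrite inE => /andP[_]; rewrite inE.
have NE : N = (fine N)%:E by rewrite fineK// ge0_fin_numE.
have [NZ|NZ] := eqVneq (fine N) 0.
  have fz : f = cst 0 %[ae pi].
    have mef : measurable_fun setT (EFin \o f) by exact/measurable_EFinP.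
    have : {ae pi, forall x, setT x -> (EFin \o f) x = 0%E}.
      by apply: (@Lnorm_eq0_eq0 _ _ _ pi (EFin \o f) 2%:E) => //; rewrite -/N NE NZ.
    by apply: filterS => x /(_ I) [].
  have Kfz : markov_op K f = cst 0 %[ae pi].
    have := ae_eq_markov_op hpi mf (@measurable_cst _ _ _ _ _ _) fz.
    apply: filterS => x /(_ I) ->; rewrite /markov_op Rintegral_cst//= mul0r//.
  rewrite NE NZ mule0 (ae_eq_Lnorm _ mKf (@measurable_cst _ _ _ _ _ _) Kfz).
  by rewrite (@Lnorm0 _ _ _ pi 2%:E)// eqe.
have n0 : 0 < fine N by rewrite lt_neqAle eq_sym NZ fine_ge0.
pose c := (fine N)^-1.
have c0 : 0 < c by rewrite invr_gt0.
have mg : measurable_fun setT (fun x => c * f x) by exact: measurable_funM.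
have Ng : ('N[pi]_2%:E[EFin \o (fun x => c * f x)%R] = 1)%E.
  rewrite Lnorm_scale// -/N NE -EFinM gtr0_norm//.
  by rewrite /c mulVf.
have gL : Lfun0 pi 2 (fun x => c * f x).
  split; last by rewrite RintegralZl// f0 mulr0.
  rewrite inE; apply/andP; rewrite !inE/=; split => //.
  by rewrite /finite_norm Ng ltry.
have : ('N[pi]_2%:E[EFin \o markov_op K (fun x => (c * f x)%R)] <= kappa%:E)%E.
  apply: le_trans gap; apply: ereal_sup_ubound; exists (fun x => c * f x) => //.
  by split => //; rewrite Ng.
have -> : ('N[pi]_2%:E[EFin \o markov_op K (fun x => (c * f x)%R)] =
           c%:E * 'N[pi]_2%:E[EFin \o markov_op K f])%E.
  rewrite -[c in RHS]gtr0_norm// -Lnorm_scale//.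
  apply: ae_eq_Lnorm; [exact: measurable_markov_op|exact: measurable_funM|].
  exact: markov_opZ.
by rewrite lee_pdivrMl// => h; rewrite NE muleC.
Qed.

Lemma sqr_iter_markov_op_le n f : measurable_fun setT f ->
  (\int[pi]_x (f x ^+ 2)%:E < +oo)%E -> \int[pi]_x f x = 0 ->
  (\int[pi]_x (Kn n f x ^+ 2)%:E <= ((kappa ^+ n) ^+ 2)%:E * \int[pi]_x (f x ^+ 2)%:E)%E.
Proof.
move=> mf f2 f0; have fi := sqr_integrable mf f2.
elim: n => [|n IH] /=; first by rewrite expr1n mul1e.
have mn := measurable_iter_markov_op n mf.
have fin2 : (\int[pi]_x (Kn n f x ^+ 2)%:E < +oo)%E.
  by apply: (le_lt_trans IH); rewrite lte_mul_pinfty// lee_fin sqr_ge0.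
have z : \int[pi]_x Kn n f x = 0 by rewrite Rintegral_iter_markov_op.
apply: (@le_trans _ _ ((kappa ^+ 2)%:E * \int[pi]_x (Kn n f x ^+ 2)%:E)%E); last first.
  rewrite (exprS kappa n) exprMn (EFinM (kappa ^+ 2)) -muleA.
  by apply: lee_wpmul2l => //; rewrite lee_fin sqr_ge0.
rewrite !Lnorm2_sqr.
have -> : kappa ^+ 2 = kappa `^ 2 by rewrite powR_mulrn.
rewrite -poweR_EFin -poweRM ?Lnorm_ge0 ?lee_fin//.
apply: gt0_ler_poweR => //; rewrite ?in_itv/= ?leey ?andbT ?Lnorm_ge0 ?mule_ge0 ?Lnorm_ge0//.
exact: Lnorm2_markov_op_le.
Qed.

End markov_iterates.

(** * Decay of the iterates on mean-zero functions of L^p *)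

Section iterate_bounds.
Context d (T : measurableType d) {R : realType}.
Variables (K : R.-pker T ~> T) (pi : probability T R).
Hypothesis hpi : invariant_distribution K pi.
Variable kappa : R.
Hypothesis kappa_ge0 : 0 <= kappa.
Hypothesis gap : (opnorm_L20 pi K <= kappa%:E)%E.
Implicit Types (f g h : T -> R) (p : R).
Local Notation intg f := (pi.-integrable setT (EFin \o f)).
Local Notation Kn n f := (iter n (markov_op K) f).

Lemma integrable_cst_pi (c : R) : intg (cst c).
Proof. exact: finite_measure_integrable_cst. Qed.

Lemma integral_cst_pi (c : R) : (\int[pi]_x c%:E = c%:E)%E.
Proof.
rewrite integral_cst//= [X in (_ * X)%E](_ : _ = 1%E) ?mule1//.
exact: probability_setT.
Qed.

Lemma Rintegral_cst_pi (c : R) : \int[pi]_x c = c.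
Proof.
rewrite Rintegral_cst// [X in fine X](_ : _ = 1%E) ?mulr1//.
exact: probability_setT.
Qed.

(** The mean is the best constant approximation in L^2. *)
Lemma center_sqr_le h : measurable_fun setT h ->
  (\int[pi]_x (h x ^+ 2)%:E < +oo)%E ->
  (\int[pi]_x ((h x - \int[pi]_y h y) ^+ 2)%:E <= \int[pi]_x (h x ^+ 2)%:E)%E.
Proof.
move=> mh h2; have hi := sqr_integrable mh h2.
set c := \int[pi]_y h y.
have h2i : intg (fun x => h x ^+ 2).
  apply/integrableP; split; first by apply/measurable_EFinP; exact: measurable_funX.
  by under eq_integral do rewrite /= ger0_norm ?sqr_ge0//.
have ci : intg (fun x => 2 * c * h x) .
  by under [X in _.-integrable _ X]eq_fun do rewrite /= EFinM; exact: integrableZl.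
have di : intg (fun x => 2 * c * h x - c ^+ 2).
  under [X in _.-integrable _ X]eq_fun do rewrite /= EFinB.
  by apply: integrableB => //; exact: integrable_cst_pi.
have -> : (\int[pi]_x ((h x - c) ^+ 2)%:E =
   \int[pi]_x ((h x ^+ 2)%:E - (2 * c * h x - c ^+ 2)%:E))%E.
  by apply: eq_integral => x _; rewrite -EFinB; congr EFin; ring.
rewrite integralB//.
have -> : (\int[pi]_x (2 * c * h x - c ^+ 2)%:E = (c ^+ 2)%:E)%E.
  rewrite -[LHS]fineK; last exact: integrable_fin_num.
  congr EFin; rewrite -/(Rintegral _ _ _) RintegralB//; last exact: integrable_cst_pi.
  rewrite RintegralZl// -/c Rintegral_cst_pi; ring.
by rewrite leeBlDr// leeDl// lee_fin sqr_ge0.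
Qed.

(* As f has mean zero, clipping it at height t and centering both parts writes f
   as g + b with g and b of mean zero, to which the spectral gap applies. *)
Section clip_decomposition.
Variables (f : T -> R) (t : R).
Hypotheses (fi : intg f) (f0 : \int[pi]_x f x = 0) (t_gt0 : 0 < t).

Let a x := clip t (f x).
Let c := \int[pi]_x a x.

Let mf : measurable_fun setT f.
Proof. by apply/measurable_EFinP; exact: measurable_int fi. Qed.

Let ma : measurable_fun setT a.
Proof.
apply: (measurableT_comp measurable_clip (g := fun x => (t, f x))).
exact: measurable_fun_pair.
Qed.

Let a_le x : `|a x| <= t.
Proof. by apply: normr_clip_le; exact: ltW. Qed.

Let ai : intg a.
Proof.
apply: (le_integrable measurableT _ _ (integrable_cst_pi t)).
  exact/measurable_EFinP.
by move=> x _ /=; rewrite lee_fin (le_trans (a_le x))// ler_norm.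
Qed.

Let fai : intg (fun x => f x - a x).
Proof. by under [X in _.-integrable _ X]eq_fun do rewrite /= EFinB; exact: integrableB. Qed.

Let cE : \int[pi]_x (f x - a x) = - c.
Proof. by rewrite RintegralB// f0 sub0r. Qed.

Let c_le : `|c| <= t.
Proof.
apply: (le_trans (le_normr_Rintegral measurableT ai)).
rewrite -[leRHS]Rintegral_cst_pi; apply: le_Rintegral => //.
- exact: integrable_norm.
- exact: integrable_cst_pi.
Qed.

Let g x := a x - c.
Let b x := f x - a x + c.

Let gi : intg g.
Proof.
under [X in _.-integrable _ X]eq_fun do rewrite /= EFinB.
by apply: integrableB => //; exact: integrable_cst_pi.
Qed.

Let bi : intg b.
Proof.
under [X in _.-integrable _ X]eq_fun do rewrite /= EFinD.
by apply: integrableD => //; exact: integrable_cst_pi.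
Qed.

Let mg : measurable_fun setT g.
Proof. exact: measurable_funB. Qed.

Let mb : measurable_fun setT b.
Proof. by apply: measurable_funD => //; exact: measurable_funB. Qed.

Let fgb n : Kn n f = Kn n g \+ Kn n b %[ae pi].
Proof.
have -> : f = g \+ b by apply/funext => x /=; rewrite /g /b; ring.
exact: iter_markov_opD.
Qed.

(** Centering does not increase the L^2 norm of the clipped part, and the constant
    c, being minus the mean of the remainder, at most doubles the L^1 norm of the
    remainder: whence the factors 1 and 2. *)
Lemma clip_decomposition_L1_L2 n : exists A B : T -> R,
  [/\ measurable_fun setT A, measurable_fun setT B, Kn n f = A \+ B %[ae pi],
     (\int[pi]_x (A x ^+ 2)%:E <=
        ((kappa ^+ n) ^+ 2)%:E * \int[pi]_x (clip t (f x) ^+ 2)%:E)%E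
   & (\int[pi]_x `|B x|%:E <= 2%:E * \int[pi]_x `|f x - clip t (f x)|%:E)%E].
Proof.
exists (Kn n g), (Kn n b); split => //.
- exact: measurable_iter_markov_op.
- exact: measurable_iter_markov_op.
- have a2 : (\int[pi]_x (a x ^+ 2)%:E < +oo)%E.
    apply: (@le_lt_trans _ _ (\int[pi]_x (t ^+ 2)%:E)%E).
      apply: ge0_le_integral => //.
      + by move=> x _; rewrite lee_fin sqr_ge0.
      + by apply/measurable_EFinP; exact: measurable_funX.
      + move=> x _; rewrite lee_fin -ler_sqrt ?sqrtr_sqr ?sqr_ge0//.
        by rewrite (ger0_norm (ltW t_gt0)) a_le.
    by rewrite integral_cst_pi ltry.
  have g2a := center_sqr_le ma a2.
  apply: (@le_trans _ _ (((kappa ^+ n) ^+ 2)%:E * \int[pi]_x (g x ^+ 2)%:E)%E).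
    apply: sqr_iter_markov_op_le => //; first exact: le_lt_trans g2a a2.
    by rewrite /g RintegralB ?Rintegral_cst_pi ?subrr//; exact: integrable_cst_pi.
  by apply: lee_wpmul2l => //; rewrite lee_fin sqr_ge0.
- apply: (le_trans (L1_iter_markov_op_le hpi n bi)).
  have mfa : measurable_fun setT (fun x => `|f x - a x|%:E).
    by apply/measurable_EFinP; apply: measurableT_comp => //; exact: measurable_funB.
  apply: (@le_trans _ _ (\int[pi]_x (`|f x - a x|%:E + `|c|%:E))%E).
    apply: ge0_le_integral => //.
    + by apply/measurable_EFinP; exact: measurableT_comp.
    + exact: emeasurable_funD.
    + by move=> x _; rewrite -EFinD lee_fin ler_normD.
  rewrite ge0_integralD// ?integral_cst_pi.
  rewrite mule_natl mule2n leeD2l//.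
  rewrite -normrN -cE.
  apply: (@le_trans _ _ (\int[pi]_x `|f x - a x|)%:E).
    by rewrite lee_fin; exact: le_normr_Rintegral.
  rewrite /Rintegral fineK// ge0_fin_numE; last exact: integral_ge0.
  by case/integrableP: fai.
Qed.

(** The roles are exchanged: the clipped part is bounded by t and its mean too,
    while the remainder is centered in L^2. *)
Lemma clip_decomposition_L2_Loo n : (\int[pi]_x (f x ^+ 2)%:E < +oo)%E ->
  exists A B : T -> R,
  [/\ measurable_fun setT B, Kn n f = A \+ B %[ae pi],
     {ae pi, forall x, `|A x| <= 2 * t}
   & (\int[pi]_x (B x ^+ 2)%:E <=
        ((kappa ^+ n) ^+ 2)%:E * \int[pi]_x ((f x - clip t (f x)) ^+ 2)%:E)%E].
Proof.
move=> f2; exists (Kn n g), (Kn n b); split => //.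
- exact: measurable_iter_markov_op.
- apply: nearW; apply: normr_iter_markov_op_le => // x.
  by rewrite /g (le_trans (ler_normB _ _))// mulrDl mul1r lerD.
- have mfa : measurable_fun setT (fun x => f x - a x) by exact: measurable_funB.
  have h2 : (\int[pi]_x ((f x - a x) ^+ 2)%:E < +oo)%E.
    apply: le_lt_trans f2; apply: ge0_le_integral => //.
    + by move=> x _; rewrite lee_fin sqr_ge0.
    + by apply/measurable_EFinP; exact: measurable_funX.
    + by apply/measurable_EFinP; exact: measurable_funX.
    + move=> x _; rewrite lee_fin -ler_sqrt ?sqr_ge0// !sqrtr_sqr.
      by apply: normr_subr_clip_le; exact: ltW.
  have := center_sqr_le mfa h2; rewrite cE.
  under eq_integral do rewrite opprK.
  move=> b2.
  apply: (@le_trans _ _ (((kappa ^+ n) ^+ 2)%:E * \int[pi]_x (b x ^+ 2)%:E)%E).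
    apply: sqr_iter_markov_op_le => //; first exact: le_lt_trans b2 h2.
    by rewrite /b RintegralD ?cE ?Rintegral_cst_pi ?addNr//; exact: integrable_cst_pi.
  by apply: lee_wpmul2l => //; rewrite lee_fin sqr_ge0.
Qed.

End clip_decomposition.

End iterate_bounds.

Section iterate_norms.
Context d (T : measurableType d) {R : realType}.
Variables (K : R.-pker T ~> T) (pi : probability T R).
Hypothesis hpi : invariant_distribution K pi.
Variable kappa : R.
Hypothesis kappa_ge0 : 0 <= kappa.
Hypothesis gap : (opnorm_L20 pi K <= kappa%:E)%E.
Implicit Types (f g h : T -> R) (p : R).
Local Notation intg f := (pi.-integrable setT (EFin \o f)).
Local Notation Kn n f := (iter n (markov_op K) f).

Lemma Lnorm_le_pow p (C : R) f g : 0 < p -> 0 <= C ->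
  (\int[pi]_x (`|g x| `^ p)%:E <= C%:E * \int[pi]_x (`|f x| `^ p)%:E)%E ->
  ('N[pi]_p%:E[EFin \o g] <= (C `^ p^-1)%:E * 'N[pi]_p%:E[EFin \o f])%E.
Proof.
move=> p0 C0 gf; rewrite unlock /Lnorm -poweR_EFin.
have I0 h : (0 <= \int[pi]_x (`|h x| `^ p)%:E)%E.
  by apply: integral_ge0 => x _; rewrite lee_fin powR_ge0.
rewrite -poweRM ?lee_fin//; last exact: I0.
apply: gt0_ler_poweR => //; rewrite ?in_itv/= ?leey ?andbT ?invr_ge0 ?(ltW p0)//.
by rewrite mule_ge0//; exact: I0.
Qed.

Lemma powR_sqr_expr (k s : R) n : 0 <= k -> ((k ^+ n) ^+ 2) `^ s = (k `^ (2 * s)) ^+ n.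
Proof.
move=> k0; rewrite -(powR_mulrn n k0) -(powR_mulrn 2 (powR_ge0 _ _)) -powRrM.
rewrite -(powR_mulrn n (powR_ge0 _ _)) -!powRrM.
by congr (powR k _); ring.
Qed.

Lemma Lfun_pi_integrable p f : 1 <= p -> f \in Lfun pi p%:E -> intg f.
Proof.
move=> p1 fL; apply/Lfun1_integrable; apply: (Lfun_subset _ _ _ _ fL) => //.
by rewrite fin_num_measure.
Qed.

Lemma Lnorm_iter_markov_op_lt2 p f n : 1 < p < 2 -> Lfun0 pi p f ->
  ('N[pi]_p%:E[EFin \o Kn n f] <=
     (2 `^ (2 / p - 1) * (kappa `^ (2 * ((p - 1) / p))) ^+ n)%:E
     * 'N[pi]_p%:E[EFin \o f])%E.
Proof.
move=> p12 [fL f0]; have /andP[p1 p2] := p12.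
have p0 : 0 < p by lra.
have fi := Lfun_pi_integrable (ltW p1) fL.
move/(LfunE pi f (lt0r_neq0 p0)) : fL => [mf fp].
have := @interpolation_L1_L2 _ T R pi p (Kn n f) f 2 ((kappa ^+ n) ^+ 2)
  p12 (ltr0Sn _ _) (sqr_ge0 _) (measurable_iter_markov_op _ _ mf) mf fp.
move=> /(_ (fun t t0 => clip_decomposition_L1_L2 hpi kappa_ge0 gap fi f0 t0 n)).
move/(Lnorm_le_pow p0) => /(_ (mulr_ge0 (powR_ge0 _ _) (powR_ge0 _ _))).
rewrite powRM ?powR_ge0// -!powRrM powR_sqr_expr//.
by rewrite (_ : (2 - p) / p = 2 / p - 1)//; field; rewrite gt_eqF.
Qed.

Lemma Lnorm_iter_markov_op_gt2 p f n : 2 < p -> Lfun0 pi p f ->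
  ('N[pi]_p%:E[EFin \o Kn n f] <=
     (2 `^ (1 - 2 / p) * (kappa `^ (2 / p)) ^+ n)%:E
     * 'N[pi]_p%:E[EFin \o f])%E.
Proof.
move=> p2 [fL f0].
have p0 : 0 < p by lra.
have p1 : 1 <= p by lra.
have fi := Lfun_pi_integrable p1 fL.
have f2 : (\int[pi]_x (f x ^+ 2)%:E < +oo)%E.
  apply: (proj2 ((Lfun2E pi f).1 _)); apply: (Lfun_subset _ _ _ _ fL) => //.
  - by rewrite lee_fin ler1n.
  - by rewrite fin_num_measure.
  - by rewrite lee_fin ltW.
move/(LfunE pi f (lt0r_neq0 p0)) : fL => [mf fp].
have := @interpolation_L2_Loo _ T R pi p (Kn n f) f 2 ((kappa ^+ n) ^+ 2)
  p2 (ltr0Sn _ _) (sqr_ge0 _) (measurable_iter_markov_op _ _ mf) mf.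
move=> /(_ (fun t t0 => clip_decomposition_L2_Loo hpi kappa_ge0 gap fi f0 t0 n f2)).
move/(Lnorm_le_pow p0) => /(_ (mulr_ge0 (powR_ge0 _ _) (sqr_ge0 _))).
rewrite powRM ?powR_ge0 ?sqr_ge0// -!powRrM powR_sqr_expr//.
by rewrite (_ : (p - 2) / p = 1 - 2 / p)//; field; rewrite gt_eqF.
Qed.

Lemma Lnorm_iter_markov_op_eq2 f n : Lfun0 pi 2 f ->
  ('N[pi]_2%:E[EFin \o Kn n f] <= (kappa ^+ n)%:E * 'N[pi]_2%:E[EFin \o f])%E.
Proof.
move=> [/Lfun2E[mf f2] f0].
have := sqr_iter_markov_op_le hpi kappa_ge0 gap n mf f2 f0.
have sqrE h : (\int[pi]_x (h x ^+ 2)%:E = \int[pi]_x (`|h x| `^ 2)%:E)%E.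
  by apply: eq_integral => x _; rewrite powR_mulrn// real_normK ?num_real.
rewrite !sqrE => H.
have := Lnorm_le_pow (ltr0Sn _ _) (sqr_ge0 _) H.
by rewrite powR_sqr_expr// divff// powRr1.
Qed.

End iterate_norms.

(** * Almost everywhere limits in L^p *)

Section Lp_series.
Context {R : realType}.


(** At a positive limit this is continuity of the power function. At 0 that
    function is not continuous, as it is 1 on the negative reals, and the sign of
    the sequence is used. *)
Lemma cvg_powR_ge0 (p l : R) (u : R ^nat) : 0 < p -> (forall n, 0 <= u n) ->
  u @ \oo --> l -> (fun n => u n `^ p) @ \oo --> l `^ p.
Proof.
move=> p0 u0 ul.
have : 0 <= l by apply: (cvgr_to_ge ul); exact: nearW.
rewrite le_eqVlt => /predU1P[l0|l0].
  rewrite -l0 powR0 ?gt_eqF//; rewrite -l0 in ul.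
  apply/cvgr0Pnorm_lt => e e0.
  have e1 : 0 < e `^ p^-1 by rewrite powR_gt0.
  move/cvgr0Pnorm_lt : ul => /(_ _ e1); apply: filterS => n.
  rewrite ger0_norm// => une; rewrite ger0_norm ?powR_ge0//.
  rewrite -[ltRHS]powRr1 ?(ltW e0)// -(mulVf (lt0r_neq0 p0)) powRrM.
  by rewrite gt0_ltr_powR// nnegrE// powR_ge0.
apply: (@continuous_cvg _ _ _ _ _ _ (fun x => x `^ p)) => //.
apply: differentiable_continuous; apply/derivable1_diffP.
by apply: derivable_powR; rewrite in_itv/= andbT.
Qed.

Lemma geometric_sum_le (rho : R) n : 0 <= rho < 1 ->
  \sum_(i < n) rho ^+ i <= (1 - rho)^-1.
Proof.
move=> /andP[r0 r1].
rewrite -[leRHS]mul1r ler_pdivlMr ?subr_gt0// mulrC.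
have -> : (1 - rho) * \sum_(i < n) rho ^+ i = 1 - rho ^+ n.
  by rewrite -opprB mulNr -subrX1 opprB.
by rewrite gerBl exprn_ge0.
Qed.

End Lp_series.

Section Lnorm_limit.
Context d (T : measurableType d) {R : realType}.
Variable mu : {measure set T -> \bar R}.

(** Fatou's lemma applied to the p-th powers. *)
Lemma Lnorm_lim_le (p B : R) (S : (T -> R) ^nat) (u : T -> R) : 0 < p -> 0 <= B ->
  (forall n, measurable_fun setT (S n)) -> measurable_fun setT u ->
  {ae mu, forall x, S ^~ x @ \oo --> u x} ->
  (forall n, 'N[mu]_p%:E[EFin \o S n] <= B%:E)%E ->
  ('N[mu]_p%:E[EFin \o u] <= B%:E)%E.
Proof.
move=> p0 B0 mS mu_ Su SB.
have mpow (h : T -> R) : measurable_fun setT h ->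
    measurable_fun setT (fun x => (`|h x| `^ p)%:E).
  move=> mh; apply/measurable_EFinP; apply: (measurableT_comp (measurable_powR _)).
  exact: measurableT_comp.
pose v n x := (`|S n x| `^ p)%:E.
have mv n : measurable_fun setT (v n) by exact: mpow.
have v0 n x : (0 <= v n x)%E by rewrite lee_fin powR_ge0.
have vB n : (\int[mu]_x v n x <= (B `^ p)%:E)%E.
  have -> : (\int[mu]_x v n x = 'N[mu]_p%:E[EFin \o S n] `^ p)%E.
    by rewrite poweR_Lnorm// gt_eqF.
  rewrite -poweR_EFin; apply: gt0_ler_poweR; rewrite ?(ltW p0) ?in_itv/= ?leey ?andbT//.
  exact: Lnorm_ge0.
have key : (\int[mu]_x (`|u x| `^ p)%:E <= (B `^ p)%:E)%E.
  have mlim : measurable_fun setT (fun x => limn_einf (v ^~ x)).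
    have -> : (fun x => limn_einf (v ^~ x)) = (fun x => - limn_esup (fun n => - v n x))%E.
      by apply/funext => x; rewrite -(limn_einfN (fun n => - v n x)%E); congr limn_einf;
        apply/funext => n /=; rewrite opprK.
    apply: measurableT_comp => //; apply: measurable_fun_limn_esup => n.
    exact: measurableT_comp.
  have einf_ge0 x : (0 <= limn_einf (v ^~ x))%E.
    rewrite limn_einf_lim; apply: lime_ge; first exact: is_cvg_einfs.
    by apply: nearW => n; apply: le_ereal_inf_tmp => _ [m /= nm <-]; exact: v0.
  apply: (@le_trans _ _ (\int[mu]_x limn_einf (v ^~ x))%E).
    apply: ae_ge0_le_integral => //.
    - exact: mpow.
    - apply: filterS Su => x Sux _.
      have : v ^~ x @ \oo --> (`|u x| `^ p)%:E.
        apply: cvg_EFin; first exact: nearW.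
        by apply: (cvg_powR_ge0 p0 (fun n => normr_ge0 (S n x))); exact: cvg_norm.
      by move/cvg_limn_einf_sup => [-> _].
  apply: (le_trans (fatou mu measurableT mv (fun n x _ => v0 n x))).
  rewrite limn_einf_lim; apply: lime_le; first exact: is_cvg_einfs.
  apply: nearW => n; apply: le_trans (vB n).
  by apply: ereal_inf_lbound; exists n => /=.
rewrite unlock /Lnorm -[leRHS]poweRe1 ?lee_fin//.
rewrite -(mulfV (lt0r_neq0 p0)) poweRrM; apply: gt0_ler_poweR => //.
- by rewrite invr_ge0 ltW.
- rewrite in_itv/= leey andbT; apply: integral_ge0 => x _.
  by rewrite lee_fin powR_ge0.
- by rewrite in_itv/= leey andbT lee_fin powR_ge0.
Qed.

End Lnorm_limit.

Section Lnorm_probability.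
Context d (T : measurableType d) {R : realType}.
Variable pi : probability T R.

(** Hoelder's inequality against the constant 1, of norm 1 for a probability. *)
Lemma L1_le_Lnorm (p : R) (f : T -> R) : 1 < p -> measurable_fun setT f ->
  (\int[pi]_x `|f x|%:E <= 'N[pi]_p%:E[EFin \o f])%E.
Proof.
move=> p1 mf; have p0 : 0 < p by lra.
have q0 : 0 < p / (p - 1) by rewrite divr_gt0// subr_gt0.
have := @hoelder _ T R pi f (cst 1) p (p / (p - 1)) mf (@measurable_cst _ _ _ _ _ _) p0 q0.
rewrite Lnorm1 => /(_ _)/le_trans.
have -> : ('N[pi]_(p / (p - 1))%:E[EFin \o cst 1%R] = 1)%E.
  by rewrite Lnorm_cst1 [X in (X `^ _)%E](_ : _ = 1%E) ?poweR1r//; exact: probability_setT.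
under eq_integral do rewrite /= mulr1.
rewrite mule1; apply => //.
by field; rewrite subr_eq0 !gt_eqF.
Qed.

End Lnorm_probability.

(** * The Neumann series *)

Section neumann.
Context d (T : measurableType d) {R : realType}.
Variables (K : R.-pker T ~> T) (pi : probability T R).
Hypothesis hpi : invariant_distribution K pi.
Variables (p C rho : R).
Hypotheses (p1 : 1 < p) (C0 : 0 <= C) (rho01 : 0 <= rho < 1).
Local Notation intg f := (pi.-integrable setT (EFin \o f)).
Local Notation Kn n f := (iter n (markov_op K) f).
Hypothesis Kn_le : forall (f : T -> R) n, Lfun0 pi p f ->
  ('N[pi]_p%:E[EFin \o Kn n f] <= (C * rho ^+ n)%:E * 'N[pi]_p%:E[EFin \o f])%E.

Let p0 : 0 < p. Proof. exact: lt_trans p1. Qed.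

Let Lp_fin f : f \in Lfun pi p%:E ->
  'N[pi]_p%:E[EFin \o f]%E = (fine 'N[pi]_p%:E[EFin \o f])%:E.
Proof.
rewrite inE => /andP[_]; rewrite inE/= /finite_norm => fL.
by rewrite fineK// ge0_fin_numE// Lnorm_ge0.
Qed.

Let Lp_meas f : f \in Lfun pi p%:E -> measurable_fun setT f.
Proof. by rewrite inE => /andP[/[!inE]]. Qed.

(** Such a w is K^n w for every n, so its norm is at most C rho^n times itself. *)
Lemma markov_op_fixed_eq0 w : Lfun0 pi p w ->
  markov_op K w = w %[ae pi] -> w = cst 0 %[ae pi].
Proof.
move=> w0 Kw; have [wL _] := w0.
have mw := Lp_meas wL.
have Knw n : Kn n w = w %[ae pi].
  elim: n => [|n IH]; first exact: nearW.
  have := ae_eq_markov_op hpi (measurable_iter_markov_op K n mw) mw IH.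
  by apply: filterS2 Kw => x Kwx; rewrite /= => + _ => ->//; exact: Kwx.
have NKn n : ('N[pi]_p%:E[EFin \o Kn n w] = 'N[pi]_p%:E[EFin \o w])%E.
  by apply: ae_eq_Lnorm => //; exact: measurable_iter_markov_op.
have N0 : ('N[pi]_p%:E[EFin \o w] = 0)%E.
  rewrite (Lp_fin wL); set x := fine _.
  have x0 : 0 <= x by apply: fine_ge0; exact: Lnorm_ge0.
  have xle n : x <= (C * rho ^+ n) * x.
    by rewrite -lee_fin EFinM /x -(Lp_fin wL) -{1}(NKn n); exact: Kn_le.
  have /eqP : x = 0 => [|/eqP->//].
  have [//|xn0] := eqVneq x 0; exfalso.
  have xgt0 : 0 < x by rewrite lt_neqAle eq_sym xn0.
  have : geometric C rho @ \oo --> 0.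
    by apply: cvg_geometric; case/andP: rho01 => r0 r1; rewrite ger0_norm.
  move/cvgr0Pnorm_lt => /(_ _ ltr01)[n _ /(_ n (leqnn _))/=].
  rewrite ltNge => /negP; apply.
  apply: le_trans (ler_norm _); rewrite -(@ler_pM2r _ x)// mul1r; exact: xle.
have mew : measurable_fun setT (EFin \o w) by exact/measurable_EFinP.
have : {ae pi, forall x, setT x -> (EFin \o w) x = 0%E}.
  by apply: (@Lnorm_eq0_eq0 _ _ _ pi (EFin \o w) p%:E) => //; rewrite lte_fin.
by apply: filterS => x /(_ I) [].
Qed.

Lemma poisson_solution_unique f u v :
  poisson_solution pi K p f u -> poisson_solution pi K p f v -> v = u %[ae pi].
Proof.
move=> [[uL u0] Eu] [[vL v0] Ev].
have ui := Lfun_pi_integrable (ltW p1) uL.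
have vi := Lfun_pi_integrable (ltW p1) vL.
have p1e : (1 <= p%:E)%E by rewrite lee_fin ltW.
have wL : Lfun0 pi p (v \- u).
  split; first by rewrite -[v \- u]/(v - u); exact: (@rpredB _ (Lfun pi p%:E)).
  by rewrite RintegralB// u0 v0 subrr.
have Kw : markov_op K (v \- u) = v \- u %[ae pi].
  have := markov_opB hpi vi ui; apply: filterS3 Eu Ev => x /(_ I) + /(_ I) + /(_ I).
  move=> uE vE + _ => ->/=.
  move: uE vE; lra.
by apply: filterS (markov_op_fixed_eq0 wL Kw) => x /(_ I) /= /eqP; rewrite subr_eq0 => /eqP.
Qed.

Section existence.
Variable f : T -> R.
Hypothesis f0 : Lfun0 pi p f.

Let F n := Kn n f.
Let S n x := \sum_(i < n) F i x.
Let N := fine 'N[pi]_p%:E[EFin \o f]%E.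
Let B := C / (1 - rho) * N.
Let g x := (\sum_(0 <= n <oo) `|F n x|%:E)%E.
(* The limit superior makes u measurable everywhere; wherever g is finite it is
   the sum of the series. *)
Let u x := fine (limn_esup (fun n => (S n x)%:E)).

Let fL : f \in Lfun pi p%:E. Proof. by case: f0. Qed.
Let mf : measurable_fun setT f. Proof. exact: Lp_meas. Qed.
Let fi : intg f. Proof. exact: Lfun_pi_integrable (ltW p1) fL. Qed.
Let N0 : 0 <= N. Proof. by apply: fine_ge0; exact: Lnorm_ge0. Qed.
Let mF n : measurable_fun setT (F n). Proof. exact: measurable_iter_markov_op. Qed.
Let Fi n : intg (F n). Proof. exact: integrable_iter_markov_op. Qed.

Let mS n : measurable_fun setT (S n).
Proof. exact: measurable_sum. Qed.

Let S_recr n : S n.+1 = S n \+ F n.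
Proof. by apply/funext => x; rewrite /S big_ord_recr. Qed.

Let S0 : S 0%N = cst 0.
Proof. by apply/funext => x; rewrite /S big_ord0. Qed.

Let F_le n : ('N[pi]_p%:E[EFin \o F n] <= (C * rho ^+ n * N)%:E)%E.
Proof. by rewrite EFinM /N -Lp_fin//; exact: Kn_le. Qed.

Let sum_le n : \sum_(i < n) C * rho ^+ i * N <= B.
Proof.
rewrite -mulr_suml -mulr_sumr ler_wpM2r// ler_wpM2l//.
exact: geometric_sum_le.
Qed.

Let S_le n : ('N[pi]_p%:E[EFin \o S n] <= B%:E)%E.
Proof.
apply: (@le_trans _ _ (\sum_(i < n) C * rho ^+ i * N)%:E); last by rewrite lee_fin.
elim: n => [|n IH].
  by rewrite S0 big_ord0 (@Lnorm0 _ _ _ pi p%:E)// eqe gt_eqF.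
rewrite S_recr big_ord_recr/= EFinD.
apply: (le_trans (eminkowski pi (mS n) (mF n) _)); first by rewrite lee_fin ltW.
exact: leeD.
Qed.

Let mabsF n : measurable_fun setT (fun x => `|F n x|%:E).
Proof. by apply/measurable_EFinP; exact: measurableT_comp. Qed.

Let mg : measurable_fun setT g.
Proof. by apply: ge0_emeasurable_sum => // n x _ _; rewrite lee_fin. Qed.

Let g_ge0 x : (0 <= g x)%E.
Proof. by apply: nneseries_ge0 => n _ _; rewrite lee_fin. Qed.

Let gi : pi.-integrable setT g.
Proof.
apply/integrableP; split; first exact: mg.
under eq_integral do rewrite gee0_abs//.
apply: (@le_lt_trans _ _ B%:E); last exact: ltry.
rewrite integral_nneseries//.
apply: lime_le.
  by apply: is_cvg_nneseries => n _ _; apply: integral_ge0 => x _; rewrite lee_fin.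
apply: nearW => n; rewrite big_mkord.
apply: (@le_trans _ _ (\sum_(i < n) (C * rho ^+ i * N)%:E)%E).
  by apply: lee_sum => i _; apply: le_trans (F_le i); exact: L1_le_Lnorm.
by rewrite sumEFin lee_fin.
Qed.

Let S_le_g n x : (`|S n x|%:E <= g x)%E.
Proof.
apply: (@le_trans _ _ (\sum_(0 <= i < n) `|F i x|%:E)%E).
  by rewrite sumEFin lee_fin big_mkord ler_norm_sum.
by apply: nneseries_lim_ge => i _ _; rewrite lee_fin.
Qed.

Let S_cvg x : g x \is a fin_num -> S ^~ x @ \oo --> u x.
Proof.
move=> gx.
have : cvgn (series (fun n => F n x)).
  apply: normed_cvg; apply: nnseries_is_cvg; first by move=> i /=.
  by rewrite -/(g x) ltey_eq gx.
have -> : series (fun n => F n x) = S ^~ x.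
  by apply/funext => n; rewrite /series/= big_mkord.
move=> Sx; suff -> : u x = limn (S ^~ x) by [].
rewrite /u; have Sl : (fun n => (S n x)%:E) @ \oo --> (limn (S ^~ x))%:E.
  by apply: cvg_EFin; [exact: nearW|exact: Sx].
by have [_ ->] := cvg_limn_einf_sup Sl.
Qed.

Let g_fin : {ae pi, forall x, g x \is a fin_num}.
Proof. by apply: filterS (integrable_ae measurableT gi) => x /(_ I). Qed.

Let mu_u : measurable_fun setT u.
Proof.
apply: (measurableT_comp (fine_measurable _)) => //.
by apply: measurable_fun_limn_esup => n; exact/measurable_EFinP.
Qed.

Let u_le : ('N[pi]_p%:E[EFin \o u] <= B%:E)%E.
Proof.
apply: (@Lnorm_lim_le _ _ _ pi p B S u p0) => //.
- by rewrite mulr_ge0// divr_ge0// subr_ge0; case/andP: rho01 => _ /ltW.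
- by apply: filterS g_fin => x; exact: S_cvg.
Qed.

Let uL : u \in Lfun pi p%:E.
Proof.
rewrite inE; apply/andP; rewrite !inE/=; split => //.
by apply: (le_lt_trans u_le); rewrite ltry.
Qed.

Let intS n : \int[pi]_x S n x = 0 /\ intg (S n).
Proof.
elim: n => [|n [IH1 IH2]].
  rewrite S0; split; last exact: integrable0.
  by rewrite Rintegral_cst// mul0r.
rewrite S_recr; split; last exact: (integrableD measurableT IH2 (Fi n)).
rewrite RintegralD// IH1 add0r Rintegral_iter_markov_op//; by case: f0.
Qed.

Let S_cvge x : g x \is a fin_num -> (EFin \o S n) x @[n --> \oo] --> (EFin \o u) x.
Proof. by move=> gx; apply: cvg_EFin; [exact: nearW|exact: S_cvg]. Qed.

(* The measure is kept general: pi itself gives the mean of u, and K x the value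
   at x of K u. *)
Let integral_S_cvg (mu : {measure set T -> \bar R}) :
  mu.-integrable setT g -> {ae mu, forall x, g x \is a fin_num} ->
  mu.-integrable setT (EFin \o u) /\
  (\int[mu]_x (S n x)%:E)%E @[n --> \oo] --> (\int[mu]_x (u x)%:E)%E.
Proof.
move=> gmu gfin.
have [? _ lim] : [/\ mu.-integrable setT (EFin \o u),
    [sequence (\int[mu]_x `|(EFin \o S n) x - (EFin \o u) x|)%E]_n @ \oo --> 0%E &
    [sequence (\int[mu]_x (EFin \o S n) x)%E]_n @ \oo --> (\int[mu]_x (EFin \o u) x)%E].
  apply: (@dominated_convergence _ _ _ mu setT measurableT
    (fun n => EFin \o S n) (EFin \o u) g) => //.
  - by move=> n; exact/measurable_EFinP.
  - exact/measurable_EFinP.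
  - by apply: filterS gfin => x gx _; exact: S_cvge.
  - by apply: nearW => x n _; exact: S_le_g.
by split.
Qed.

Let int_u : \int[pi]_x u x = 0.
Proof.
have [_ lim] := integral_S_cvg gi g_fin.
have S0E : (fun n => \int[pi]_x (S n x)%:E)%E = cst 0%E.
  apply/funext => n; rewrite -[LHS]fineK; first by rewrite -/(Rintegral _ _ _) (intS n).1.
  by apply: integrable_fin_num => //; exact: (intS n).2.
have : (fun n => \int[pi]_x (S n x)%:E)%E @ \oo --> 0%E by rewrite S0E; exact: cvg_cst.
by move=> /(cvg_unique _ lim) h; rewrite /Rintegral h.
Qed.

Let markov_op_S n : {ae pi, forall x, markov_op K (S n) x = S n.+1 x - f x}.
Proof.
elim: n => [|n IH].
  apply: nearW => x; rewrite S_recr S0/= add0r subrr.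
  by rewrite /markov_op Rintegral_cst// mul0r.
have KD := markov_opD hpi (intS n).2 (Fi n); apply: filterS2 KD IH => x /(_ I) + IH.
rewrite -S_recr => ->/=; rewrite IH (S_recr n.+1)/= /F/=; ring.
Qed.

Let poisson_eq : (fun x => u x - markov_op K u x) = f %[ae pi].
Proof.
have KS : {ae pi, forall x, forall n, markov_op K (S n) x = S n.+1 x - f x}.
  exact: ae_foralln.
have Kg := integrable_kernel hpi gi.
have Kgfin := ae_kernel hpi g_fin.
move: KS; apply: filterS3 Kg (filterI Kgfin g_fin) => x gx [Kgfin_x gfin_x] KSx _.
have [ui lim] := integral_S_cvg gx Kgfin_x.
have lim1 : markov_op K (S n) x @[n --> \oo] --> markov_op K u x.
  apply: (@fine_cvg _ _ _ _ (fun n => \int[K x]_y (S n y)%:E)%E).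
  by rewrite /markov_op /Rintegral fineK//; exact: integrable_fin_num.
have lim2 : S n.+1 x - f x @[n --> \oo] --> u x - f x.
  apply: cvgB; last exact: cvg_cst.
  by have := S_cvg gfin_x; rewrite -(cvg_shiftS (S ^~ x)).
have : markov_op K u x = u x - f x.
  apply: (cvg_unique _ lim1) => //.
  by have -> : (fun n => markov_op K (S n) x) = (fun n => S n.+1 x - f x) by apply/funext.
by move=> ->; rewrite opprB addrC subrK.
Qed.

Lemma poisson_solution_exists : exists u : T -> R,
  poisson_solution pi K p f u /\
  ('N[pi]_p%:E[EFin \o u] <= (C / (1 - rho))%:E * 'N[pi]_p%:E[EFin \o f])%E.
Proof. by exists u; split; [|rewrite (Lp_fin fL) -EFinM]. Qed.

End existence.
End neumann.

(** * Poisson's equation *)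

Lemma opnorm_L20_ge0 d (T : measurableType d) (R : realType)
    (K : R.-pker T ~> T) (pi : probability T R) : (0 <= opnorm_L20 pi K)%E.
Proof.
apply: (le_trans (Lnorm_ge0 pi 2%:E (EFin \o markov_op K (cst 0)))).
apply: ereal_sup_ubound; exists (cst 0) => //; split; last first.
  by rewrite (@Lnorm0 _ _ _ pi 2%:E)// eqe.
by split; [exact: Lfun_cst|rewrite Rintegral_cst// mul0r].
Qed.

Lemma powR_lt1 (R : realType) (k s : R) : 0 <= k < 1 -> 0 < s -> 0 <= k `^ s < 1.
Proof.
move=> /andP[k0 k1] s0; rewrite powR_ge0/= (_ : 1 = 1 `^ s); last by rewrite powR1.
by apply: gt0_ltr_powR; rewrite ?nnegrE.
Qed.

Theorem theorem3p8 (R : realType) (X : ptopologicalType) (hX : polish R X)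
    (K : R.-pker (borel X) ~> (borel X)) (pi : probability (borel X) R)
    (hpi : invariant_distribution K pi) (p : R) (hp : 1 < p)
    (f : borel X -> R) (hf : Lfun0 pi p f)
    (gap : (opnorm_L20 pi K < 1)%E) :
  let kappa : R := fine (opnorm_L20 pi K) in
  exists u : borel X -> R,
    [/\ poisson_solution pi K p f u,
        forall v : borel X -> R, poisson_solution pi K p f v -> v = u %[ae pi],
        p < 2 ->
          ('N[pi]_p%:E[EFin \o u]
             <= (2 `^ (2 / p) / (1 - kappa `^ (2 * ((p - 1) / p))))%:E
                * 'N[pi]_p%:E[EFin \o f])%E,
        p = 2 ->
          ('N[pi]_p%:E[EFin \o u]
             <= (1 / (1 - kappa))%:E * 'N[pi]_2%:E[EFin \o f])%E
      & 2 < p ->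
          ('N[pi]_p%:E[EFin \o u]
             <= (2 `^ (2 * ((p - 1) / p)) / (1 - kappa `^ (2 / p)))%:E
                * 'N[pi]_p%:E[EFin \o f])%E].
Proof.
move=> kappa.
have op0 := opnorm_L20_ge0 K pi.
have opE : opnorm_L20 pi K = kappa%:E.
  by rewrite fineK// ge0_fin_numE// (lt_trans gap)// ltry.
have k0 : 0 <= kappa by exact: fine_ge0.
have k1 : kappa < 1 by rewrite -lte_fin -opE.
have k01 : 0 <= kappa < 1 by rewrite k0.
have gapk : (opnorm_L20 pi K <= kappa%:E)%E by rewrite opE.
have p0 : 0 < p by lra.
have weaken (a b rho : R) (u : borel X -> R) : a <= b -> 0 <= rho < 1 ->
    ('N[pi]_p%:E[EFin \o u] <= (2 `^ a / (1 - rho))%:E * 'N[pi]_p%:E[EFin \o f])%E ->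
    ('N[pi]_p%:E[EFin \o u] <= (2 `^ b / (1 - rho))%:E * 'N[pi]_p%:E[EFin \o f])%E.
  move=> ab /andP[_ r1] /le_trans; apply; apply: lee_wpmul2r; first exact: Lnorm_ge0.
  rewrite lee_fin ler_wpM2r ?invr_ge0 ?subr_ge0 ?(ltW r1)//.
  by rewrite ler_powR// ler1n.
have [p2|p2|p2] := ltgtP p 2.
- have s0 : 0 < 2 * ((p - 1) / p) by rewrite mulr_gt0// divr_gt0// subr_gt0.
  have rho01 := powR_lt1 k01 s0.
  have p12 : 1 < p < 2 by rewrite hp.
  have bnd g n (g0 : Lfun0 pi p g) := Lnorm_iter_markov_op_lt2 hpi k0 gapk n p12 g0.
  have [u [uS uN]] := poisson_solution_exists hpi hp (powR_ge0 _ _) rho01 bnd hf.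
  exists u; split => //.
  + by move=> v vS; apply: (poisson_solution_unique hpi hp rho01 bnd uS vS).
  + by move=> _; apply: weaken uN => //; lra.
  + by move=> pE; exfalso; move: p2; rewrite pE ltxx.
- have s0 : 0 < 2 / p by rewrite divr_gt0.
  have rho01 := powR_lt1 k01 s0.
  have bnd g n (g0 : Lfun0 pi p g) := Lnorm_iter_markov_op_gt2 hpi k0 gapk n p2 g0.
  have [u [uS uN]] := poisson_solution_exists hpi hp (powR_ge0 _ _) rho01 bnd hf.
  exists u; split => //.
  + by move=> v vS; apply: (poisson_solution_unique hpi hp rho01 bnd uS vS).
  + by move=> pE; exfalso; move: p2; rewrite pE ltxx.
  + move=> _; apply: weaken uN => //.
    rewrite (_ : 2 * ((p - 1) / p) = 1 - 2 / p + 1) ?lerDl//.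
    by field; rewrite gt_eqF.
- subst p.
  have bnd g n (g0 : Lfun0 pi 2 g) :
      ('N[pi]_2%:E[EFin \o iter n (markov_op K) g] <=
       (1 * kappa ^+ n)%:E * 'N[pi]_2%:E[EFin \o g])%E.
    by rewrite mul1r; have := (Lnorm_iter_markov_op_eq2 hpi k0 gapk n g0).
  have [u [uS uN]] := poisson_solution_exists hpi hp ler01 k01 bnd hf.
  exists u; split => //.
  by move=> v vS; apply: (poisson_solution_unique hpi hp k01 bnd uS vS).
Qed.
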